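(* Let $$A(v)=\int_0^\infty\left(\frac{1}{xv}-\frac{1}{e^{xv}-1}\right)\left(\frac1x-\frac{1}{e^x-1}\right)dx,\qquad v>0.$$ Then $A$ is infinitely differentiable on $(0,\infty)$ and for every integer $k\ge0$, $$A^{(k)}(1)=(-1)^kk!\left((1+\delta_{k,0})C-\frac{1}{2(k+1)}-\frac{H_{k-1}}{2}+\sum_{j=2}^{k}\binom{k}{j-1}\frac{\zeta(j)B_j}{j}\right).$$
   Context: $C=\frac{\log(2\pi)-\gamma}{2}$ where $\gamma$ is the Euler–Mascheroni constant. $H_k=\sum_{j=1}^k\frac1j$ for $k\ge1$, with $H_{-1}=H_0=0$. $\delta_{k,0}$ is the Kronecker delta. The Bernoulli numbers $B_n$ are defined by $\frac{t}{e^t-1}=\sum_{n\ge0}B_n\frac{t^n}{n!}$. $\zeta$ is the Riemann zeta function. Empty sums are $0$. *)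

(* Defs.v *)
From Stdlib Require Import Reals List Factorial Binomial.
From Coquelicot Require Import Coquelicot.
Open Scope R_scope.

Definition phi (t : R) : R := / t - / (exp t - 1).

Definition integrandA (v x : R) : R := phi (x * v) * phi x.

Definition A (v : R) : R :=
  RInt_gen (integrandA v) (at_right 0) (Rbar_locally p_infty).

Fixpoint harmonic (k : nat) : R :=
  match k with
  | O => 0
  | S k' => harmonic k' + / INR (S k')
  end.

Definition euler_gamma : R := real (Lim_seq (fun n => harmonic n - ln (INR n))).

Definition Cconst : R := (ln (2 * PI) - euler_gamma) / 2.

Definition zeta (s : nat) : R := Series (fun n => / (INR n + 1) ^ s).

(* Bernoulli numbers via the generating function t/(e^t-1) = sum B_n t^n/n!,
   i.e. B_n is the n-th derivative at 0 of the (continuously extended)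
   function t/(e^t - 1). *)
Definition bern_gen (t : R) : R := if Req_EM_T t 0 then 1 else t / (exp t - 1).
Definition Bernoulli (n : nat) : R := Derive_n bern_gen n 0.

Definition kron0 (k : nat) : R := match k with O => 1 | _ => 0 end.

Definition rhs (k : nat) : R :=
  (-1) ^ k * INR (Factorial.fact k) *
  ((1 + kron0 k) * Cconst - / (2 * INR (k + 1)) - harmonic (k - 1) / 2
   + fold_right Rplus 0
       (map (fun j => Binomial.C k (j - 1) * zeta j * Bernoulli j / INR j)
            (List.seq 2 (k - 1)))).

(* Main.v *)
(* Let p be the smooth extension of phi to 0 and g(x) = 1/(e^x - 1) = 1/x - p(x).
   Differentiating under the integral sign gives
   A^(k)(v) = int x^k p^(k)(xv) p(x) dx.  Put q_m = (-1)^m x^m g^(m) / m! and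
   z_m = 1/x - q_m = (-1)^m x^m p^(m) / m!, so that A^(k)(1) = (-1)^k k! int z_k z_0.
   The functional equation t g(x) g(x+t) = b(t) (g(x) - g(x+t)) - t g(x+t), where
   b(t) = t/(e^t - 1) generates the Bernoulli numbers, linearises the product g g^(k):
   comparing (k+1)-st derivatives at t = 0 yields, for k >= 1,
     z_k z_0 = h + (z_k - z_{k+1})/x + (q_0 - q_k)/2
               + sum_{2 <= j <= k} (-1)^j B_j/j! x^(j-1) q_{k+1-j},
   with h = z_0/x - q_0/2.  The middle terms are exact derivatives, the last ones are
   Mellin transforms of derivatives of g, i.e. multiples of zeta(j).  Finally
   h(x) (1 - e^(-Nx)) integrates, by Frullani's formula, to
   N - N ln N + ln N! - H_N/2, whose limit C follows from Wallis' product. *)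
Require Import Defs.
From Stdlib Require Import ssreflect Reals List Lra Lia.
From Coquelicot Require Import Coquelicot.
Open Scope R_scope.

(** * Improper integrals over the positive half-line *)

(** The integrals are improper at both ends, and the decomposition is chosen so that every summand
    is integrable by itself. [z m] is bounded at 0 but only of size 1/x at infinity; [q m] decays
    faster than any power at infinity but has the pole 1/x at 0. Hence [q] occurs with a positive
    power of x, in a difference such as q_0 - q_k, or paired with z_0/x in [h], where two poles
    1/(2x) cancel. No series is ever interchanged with an integral: the factor 1 - e^(-Nx) turns
    1/(e^x - 1) into a finite geometric sum at the cost of an error O(1/N). It serves for the zeta
    values as well as for [h]. The constant C splits along N - N ln N + ln N! - H_N/2 = (N - N ln N
    + ln N! - (ln N)/2) - (H_N - ln N)/2: the first bracket is Stirling's sequence with limit ln(2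
    pi)/2, the second contributes gamma/2. *)

Notation is_int f l :=
  (@is_RInt_gen R_NormedModule f (at_right 0) (Rbar_locally p_infty) l).
Notation int f :=
  (@RInt_gen R_CompleteNormedModule f (at_right 0) (Rbar_locally p_infty)).

Lemma le_div a b c : 0 < c -> a * c <= b -> a <= b / c.
Proof. intros Hc; apply (Rle_div_r a b c Hc). Qed.

Lemma div_le a b c : 0 < c -> a <= b * c -> a / c <= b.
Proof. intros Hc; apply (Rle_div_l a b c Hc). Qed.

Lemma ex_derive_continuity_pt (f : R -> R) (x : R) : ex_derive f x -> continuity_pt f x.
Proof. intros H; apply continuity_pt_filterlim, (ex_derive_continuous f x), H. Qed.

(** Since the endpoints eventually straddle 1, every later argument over a segment may assume
    [0 < a < b]. *)
Lemma pos_ends :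
  filter_prod (at_right 0) (Rbar_locally p_infty)
    (fun ab : R * R => 0 < fst ab < 1 /\ 1 < snd ab).
Proof.
apply (Filter_prod _ _ _ (fun a => 0 < a < 1) (fun b => 1 < b)).
- exists (mkposreal 1 Rlt_0_1); intros y Hy Hy0.
  rewrite /ball /= /AbsRing_ball /abs /minus /plus /opp /= in Hy.
  apply Rabs_def2 in Hy; lra.
- exists 1; auto.
- simpl; intros; lra.
Qed.

Lemma is_int_ext (f g : R -> R) (l : R) :
  (forall x, 0 < x -> f x = g x) -> is_int f l -> is_int g l.
Proof.
intros H; apply is_RInt_gen_ext.
generalize pos_ends; apply filter_imp; intros [a b] [Ha Hb] x Hx; simpl in *.
apply H; rewrite Rmin_left in Hx; lra.
Qed.

Lemma is_int_eq (f : R -> R) (l l' : R) : is_int f l -> l = l' -> is_int f l'.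
Proof. intros H <-; exact H. Qed.

Lemma is_int_plus (f g : R -> R) (lf lg : R) :
  is_int f lf -> is_int g lg -> is_int (fun x => f x + g x) (lf + lg).
Proof. exact (is_RInt_gen_plus f g lf lg). Qed.

Lemma is_int_scal (f : R -> R) (c l : R) :
  is_int f l -> is_int (fun x => c * f x) (c * l).
Proof. exact (is_RInt_gen_scal f c l). Qed.

Lemma is_int_unique (f : R -> R) (l : R) : is_int f l -> int f = l.
Proof. exact (is_RInt_gen_unique f l). Qed.

Lemma int_correct (f : R -> R) : (exists l, is_int f l) -> is_int f (int f).
Proof. exact (@RInt_gen_correct R_CompleteNormedModule _ _ _ _ f). Qed.

Lemma is_int_bound (f g : R -> R) (lf lg : R) :
  (forall x, 0 < x -> Rabs (f x) <= g x) ->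
  is_int f lf -> is_int g lg -> Rabs lf <= lg.
Proof.
intros H Hf Hg; refine (RInt_gen_norm (V := R_CompleteNormedModule) f g lf lg _ _ Hf Hg);
  generalize pos_ends; apply filter_imp; intros [a b] [Ha Hb]; simpl in *.
- lra.
- intros x Hx; apply H; lra.
Qed.

Lemma is_int_FTC (F f : R -> R) (l0 l1 : R) :
  (forall x, 0 < x -> is_derive F x (f x)) ->
  (forall x, 0 < x -> continuous f x) ->
  filterlim F (at_right 0) (locally l0) ->
  is_lim F p_infty l1 ->
  is_int f (l1 - l0).
Proof.
intros HF Hf H0 H1.
apply is_int_ext with (Derive F).
{ intros x Hx; apply is_derive_unique, HF, Hx. }
apply is_RInt_gen_Derive; auto;
  generalize pos_ends; apply filter_imp; intros [a b] [Ha Hb] x Hx; simpl in *;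
  rewrite Rmin_left in Hx; try lra.
- exists (f x); apply HF; lra.
- apply continuous_ext_loc with f; [|apply Hf; lra].
  assert (Hx0 : 0 < x) by lra.
  exists (mkposreal x Hx0); intros y Hy.
  rewrite /ball /= /AbsRing_ball /abs /minus /plus /opp /= in Hy.
  apply Rabs_def2 in Hy. symmetry; apply is_derive_unique, HF; lra.
Qed.

Lemma continuous_right_limit (F : R -> R) (l : R) :
  continuous F 0 -> F 0 = l -> filterlim F (at_right 0) (locally l).
Proof.
intros H <-; eapply filterlim_filter_le_1; [|exact H].
intros P [e He]; exists e; auto.
Qed.

Lemma filterlim_right_ext (F G : R -> R) (l : R) :
  (forall x, 0 < x -> F x = G x) ->
  filterlim F (at_right 0) (locally l) -> filterlim G (at_right 0) (locally l).
Proof.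
intros H; apply filterlim_ext_loc.
exists (mkposreal 1 Rlt_0_1); intros y _ Hy; apply H, Hy.
Qed.

Lemma is_lim_inv_p (c : R) : is_lim (fun x => c / (1 + x)) p_infty 0.
Proof.
evar_last.
- apply (is_lim_div (fun _ => c) (fun x => 1 + x) p_infty c p_infty).
  + apply is_lim_const.
  + eapply is_lim_plus; [apply is_lim_const|apply is_lim_id|reflexivity].
  + discriminate.
  + exact I.
- simpl. f_equal; ring.
Qed.

(** This is the common majorant of the development: bounded at 0, integrable at infinity, with an
    elementary primitive and total mass equal to its constant. *)
Lemma is_int_inv_sqr (c : R) : is_int (fun x => c / (1 + x) ^ 2) c.
Proof.
apply is_int_eq with (0 - (- c)); [|ring].
apply is_int_FTC with (fun x => - (c / (1 + x))).
- intros x Hx; auto_derive; [lra|field; lra].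
- intros x Hx. apply (ex_derive_continuous (fun x => c / (1 + x) ^ 2)); auto_derive.
  apply Rgt_not_eq; simpl; nra.
- apply continuous_right_limit; [|simpl; field].
  apply (ex_derive_continuous (fun x => - (c / (1 + x)))); auto_derive; lra.
- rewrite -Ropp_0; apply (is_lim_opp _ _ 0), is_lim_inv_p.
Qed.

Lemma ex_RInt_pos (f : R -> R) a b :
  (forall x, 0 < x -> continuous f x) -> 0 < a -> 0 < b -> ex_RInt f a b.
Proof.
intros H Ha Hb; apply (ex_RInt_continuous (V := R_CompleteNormedModule)).
intros x Hx; apply H.
apply Rlt_le_trans with (2 := proj1 Hx); apply Rmin_glb_lt; auto.
Qed.

(** The outer absolute value makes the bound independent of the order of [a] and [b]; in the Cauchy
    criterion the endpoints move either way. *)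
Lemma RInt_bound_pos (f : R -> R) c a b :
  (forall x, 0 < x -> continuous f x) ->
  (forall x, 0 < x -> Rabs (f x) <= c / (1 + x) ^ 2) ->
  0 < a -> 0 < b -> Rabs (RInt f a b) <= Rabs (c / (1 + a) - c / (1 + b)).
Proof.
intros Hc Hb.
assert (W : forall a b, 0 < a -> a <= b ->
   Rabs (RInt f a b) <= c / (1 + a) - c / (1 + b)).
{ intros a' b' Ha Hab.
  apply (norm_RInt_le f (fun x => c / (1 + x) ^ 2) a' b'); auto.
  - intros x Hx; apply Hb; lra.
  - apply (RInt_correct (V := R_CompleteNormedModule)), ex_RInt_pos; auto; lra.
  - evar_last.
    + apply (is_RInt_derive (fun x => - (c / (1 + x))) (fun x => c / (1 + x) ^ 2)).
      * intros x Hx; rewrite Rmin_left in Hx; auto.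
        auto_derive; [lra|field; lra].
      * intros x Hx; rewrite Rmin_left in Hx; auto.
        apply (ex_derive_continuous (fun x => c / (1 + x) ^ 2)); auto_derive.
        apply Rgt_not_eq; simpl; nra.
    + rewrite /minus /plus /opp /=; ring. }
intros Ha Hb'; destruct (Rle_dec a b) as [H|H].
- eapply Rle_trans; [apply W; auto|apply Rle_abs].
- rewrite -(opp_RInt_swap (V := R_CompleteNormedModule) f b a); [|apply ex_RInt_pos; auto].
  rewrite /opp /= Rabs_Ropp Rabs_minus_sym.
  eapply Rle_trans; [apply W; auto; lra|apply Rle_abs].
Qed.

(** Cauchy criterion in the pair of endpoints: by Chasles two integrals differ by two end pieces,
    each controlled by the variation of c/(1+x), which converges at both ends. *)
Lemma ex_int_dominated (f : R -> R) c :
  (forall x, 0 < x -> continuous f x) ->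
  (forall x, 0 < x -> Rabs (f x) <= c / (1 + x) ^ 2) ->
  exists l, is_int f l.
Proof.
intros Hc Hb.
destruct (proj1 (filterlim_locally_cauchy
   (F := filter_prod (at_right 0) (Rbar_locally p_infty))
   (fun ab : R * R => RInt f (fst ab) (snd ab)))) as [l Hl].
2:{ exists l; intros P HP; specialize (Hl P HP); unfold filtermap, filtermapi in *.
    generalize (filter_and _ _ pos_ends Hl); apply filter_imp.
    intros [a b] [[Ha Hb'] HPab]; simpl in *; eexists; split; [|exact HPab].
    apply (RInt_correct (V := R_CompleteNormedModule)), ex_RInt_pos; auto; lra. }
intros eps.
assert (L0 : filterlim (fun x => c / (1 + x)) (at_right 0) (locally c)).
{ apply continuous_right_limit; [|simpl; field].
  apply (ex_derive_continuous (fun x => c / (1 + x))); auto_derive; lra. }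
pose proof (is_lim_inv_p c) as L1.
(* Two end pieces, each bounded by the distance of two points from a common limit: four errors in
   all. *)
assert (He : 0 < eps / 4) by (destruct eps; simpl; lra).
pose (e := mkposreal _ He).
specialize (L0 _ (locally_ball c e)); specialize (L1 _ (locally_ball 0 e)).
exists (fun ab => (0 < fst ab < 1 /\ 1 < snd ab) /\
   (ball c e (c / (1 + fst ab)) /\ ball 0 e (c / (1 + snd ab)))); split.
{ apply filter_and; [apply pos_ends|].
  apply (Filter_prod _ _ _ (fun a => ball c e (c / (1 + a)))
    (fun b => ball 0 e (c / (1 + b))) L0 L1); auto. }
intros [a b] [a' b'] [[Ha Hb1] [Ba Bb]] [[Ha' Hb1'] [Ba' Bb']]; simpl in *.
rewrite /ball /= /AbsRing_ball /abs /minus /plus /opp /= in Ba Bb Ba' Bb' |- *.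
assert (E : RInt f a' b' - RInt f a b = RInt f a' a + RInt f b b').
{ rewrite -(RInt_Chasles (V := R_CompleteNormedModule) f a' a b'); try (apply ex_RInt_pos; auto; lra).
  rewrite -(RInt_Chasles (V := R_CompleteNormedModule) f a b b'); try (apply ex_RInt_pos; auto; lra).
  rewrite /plus /=; ring. }
replace (RInt f a' b' + - RInt f a b) with (RInt f a' a + RInt f b b') by (rewrite -E; ring).
eapply Rle_lt_trans; [apply Rabs_triang|].
pose proof (RInt_bound_pos f c a' a Hc Hb).
pose proof (RInt_bound_pos f c b b' Hc Hb).
assert (Rabs (c / (1 + a') - c / (1 + a)) < eps / 2).
{ apply Rabs_def2 in Ba; apply Rabs_def2 in Ba'; apply Rabs_def1; lra. }
assert (Rabs (c / (1 + b) - c / (1 + b')) < eps / 2).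
{ apply Rabs_def2 in Bb; apply Rabs_def2 in Bb'; apply Rabs_def1; lra. }
lra.
Qed.

(** * Differentiation under the integral sign *)

Lemma taylor2 (f f' f'' : R -> R) M a b x :
  (forall y, a < y < b -> is_derive f y (f' y)) ->
  (forall y, a < y < b -> is_derive f' y (f'' y)) ->
  (forall y, a < y < b -> Rabs (f'' y) <= M) ->
  a < x < b -> forall y, a < y < b ->
  Rabs (f y - f x - (y - x) * f' x) <= M * (y - x) ^ 2.
Proof.
intros H1 H2 H3 Hx y Hy.
assert (HM : 0 <= M) by (eapply Rle_trans; [apply Rabs_pos|apply (H3 x Hx)]).
assert (I : forall u v w, a < u < b -> a < v < b -> Rmin u v <= w <= Rmax u v -> a < w < b).
{ intros u v w Hu Hv; unfold Rmin, Rmax; destruct (Rle_dec u v); lra. }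
(* The mean value theorem for [f] and then for [f'] writes the remainder as f''(d) (c - x) (y - x)
   with |c - x| <= |y - x|; the sharper factor 1/2 is not sought. *)
destruct (MVT_gen f x y f') as [c [Hc Ec]].
- intros z Hz; apply H1, (I x y); auto; lra.
- intros z Hz; apply ex_derive_continuity_pt; exists (f' z); apply H1, (I x y); auto; lra.
- destruct (MVT_gen f' x c f'') as [d [Hd Ed]].
  + intros z Hz; apply H2, (I x c); auto; [apply (I x y); auto|lra].
  + intros z Hz; apply ex_derive_continuity_pt; exists (f'' z); apply H2, (I x c); auto; apply (I x y); auto.
  + assert (Hc' : a < c < b) by (apply (I x y); auto).
    assert (Hd' : a < d < b) by (apply (I x c); auto).
    replace (f y - f x - (y - x) * f' x) with (f'' d * ((c - x) * (y - x))).
    2:{ rewrite Ec. replace (f' c) with (f' x + f'' d * (c - x)) by lra. ring. }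
    rewrite Rabs_mult; apply Rmult_le_compat; auto using Rabs_pos.
    rewrite Rabs_mult -(Rabs_pos_eq ((y - x) ^ 2)); [|apply pow2_ge_0].
    rewrite /= Rmult_1_r Rabs_mult.
    apply Rmult_le_compat_r; [apply Rabs_pos|].
    unfold Rmin, Rmax in Hc; destruct (Rle_dec x y).
    * rewrite !Rabs_pos_eq; lra.
    * rewrite !Rabs_left1; lra.
Qed.

Lemma is_derive_quadratic (f : R -> R) (x l M d : R) :
  0 < d -> (forall y, Rabs (y - x) < d -> Rabs (f y - f x - (y - x) * l) <= M * (y - x) ^ 2) ->
  is_derive f x l.
Proof.
intros Hd H; apply is_derive_Reals; intros eps Heps.
assert (HM : 0 < Rmin d (eps / (Rabs M + 1))).
{ apply Rmin_glb_lt; auto; apply Rdiv_lt_0_compat; auto; generalize (Rabs_pos M); lra. }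
exists (mkposreal _ HM); simpl; intros h Hh0 Hh.
assert (Hh1 := Rlt_le_trans _ _ _ Hh (Rmin_l _ _)).
assert (Hh2 := Rlt_le_trans _ _ _ Hh (Rmin_r _ _)).
specialize (H (x + h)); replace (x + h - x) with h in H by ring.
specialize (H Hh1).
replace ((f (x + h) - f x) / h - l) with ((f (x + h) - f x - h * l) / h) by (field; auto).
unfold Rdiv; rewrite Rabs_mult Rabs_inv.
assert (0 < Rabs h) by (apply Rabs_pos_lt; auto).
apply Rmult_lt_reg_r with (Rabs h); auto.
rewrite Rmult_assoc Rinv_l; [|lra]. rewrite Rmult_1_r.
eapply Rle_lt_trans; [exact H|].
rewrite -(Rabs_pos_eq (h ^ 2)); [|apply pow2_ge_0].
rewrite -RPow_abs /= Rmult_1_r -Rmult_assoc; apply Rmult_lt_compat_r; auto.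
apply Rmult_lt_compat_r with (r := Rabs M + 1) in Hh2; [|generalize (Rabs_pos M); lra].
unfold Rdiv in Hh2; rewrite Rmult_assoc Rinv_l in Hh2; [|generalize (Rabs_pos M); lra].
generalize (Rle_abs M) (Rabs_pos h); nra.
Qed.

(* The second-order Taylor remainder is integrated directly: dominating the second
   derivative in the parameter suffices to differentiate under the integral sign. *)
Lemma is_derive_int (f f' f'' : R -> R -> R) (I I' : R -> R) (a b c v : R) :
  a < v < b ->
  (forall w x, a < w < b -> 0 < x -> is_derive (fun u => f u x) w (f' w x)) ->
  (forall w x, a < w < b -> 0 < x -> is_derive (fun u => f' u x) w (f'' w x)) ->
  (forall w x, a < w < b -> 0 < x -> Rabs (f'' w x) <= c / (1 + x) ^ 2) ->
  (forall w, a < w < b -> is_int (f w) (I w)) ->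
  is_int (f' v) (I' v) ->
  is_derive I v (I' v).
Proof.
intros Hv H1 H2 H3 HI HI'.
assert (Hd : 0 < Rmin (v - a) (b - v)) by (apply Rmin_glb_lt; lra).
apply is_derive_quadratic with c (Rmin (v - a) (b - v)); auto.
intros y Hy.
assert (Hy' : a < y < b).
{ generalize (Rmin_l (v - a) (b - v)) (Rmin_r (v - a) (b - v)).
  apply Rabs_def2 in Hy; lra. }
apply is_int_bound with (fun x => f y x - f v x - (y - v) * f' v x)
   (fun x => (c * (y - v) ^ 2) / (1 + x) ^ 2); [| |apply is_int_inv_sqr].
- intros x Hx.
  replace (c * (y - v) ^ 2 / (1 + x) ^ 2) with (c / (1 + x) ^ 2 * (y - v) ^ 2) by (field; lra).
  apply (taylor2 (fun u => f u x) (fun u => f' u x) (fun u => f'' u x) _ a b); auto.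
- apply is_int_eq with (I y + (-1) * I v + (- (y - v)) * I' v); [|ring].
  pose proof (is_int_plus _ _ _ _ (is_int_plus _ _ _ _ (HI y Hy')
    (is_int_scal _ (-1) _ (HI v Hv))) (is_int_scal _ (- (y - v)) _ HI')) as E.
  revert E; apply is_int_ext; intros x Hx; simpl; ring.
Qed.

(** * Smooth functions and their derivatives *)

(* [F n] is the n-th derivative of [F 0] on [D]; unlike [Derive_n], this also
   serves functions that are only smooth on part of the line. *)
Definition jet (D : R -> Prop) (F : nat -> R -> R) : Prop :=
  forall n x, D x -> is_derive (F n) x (F (S n) x).

(** Differentiation is local, so on an open set a jet is determined by its first entry. This is how
    one functional equation yields an identity for every order of derivative. *)
Lemma jet_eq (D : R -> Prop) (F G : nat -> R -> R) :
  open D -> jet D F -> jet D G -> (forall x, D x -> F O x = G O x) ->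
  forall n x, D x -> F n x = G n x.
Proof.
intros HD HF HG H0 n; induction n as [|n IH]; auto; intros x Hx.
rewrite -(is_derive_unique _ _ _ (HF n x Hx)) -(is_derive_unique _ _ _ (HG n x Hx)).
apply Derive_ext_loc; generalize (HD x Hx); apply filter_imp, IH.
Qed.

Lemma jet_Derive_n (D : R -> Prop) (F : nat -> R -> R) (f : R -> R) :
  open D -> jet D F -> (forall x, D x -> f x = F O x) ->
  forall n x, D x -> ex_derive_n f n x /\ Derive_n f n x = F n x.
Proof.
intros HD HF H0 n; induction n as [|n IH]; intros x Hx.
{ split; [exact I|apply H0, Hx]. }
assert (L : locally x (fun t => F n t = Derive_n f n t)).
{ generalize (HD x Hx); apply filter_imp; intros t Ht; symmetry; apply IH, Ht. }
assert (Hd : is_derive (Derive_n f n) x (F (S n) x)).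
{ exact (is_derive_ext_loc _ _ _ _ L (HF n x Hx)). }
split; [exists (F (S n) x); exact Hd|exact (is_derive_unique _ _ _ Hd)].
Qed.

Lemma open_pos : open (fun x => 0 < x).
Proof. exact (open_gt 0). Qed.

Lemma is_derive_Rmult (f g : R -> R) (x f' g' : R) :
  is_derive f x f' -> is_derive g x g' ->
  is_derive (fun t => f t * g t) x (f' * g x + f x * g').
Proof. intros Hf Hg; apply (is_derive_mult f g x f' g' Hf Hg), Rmult_comm. Qed.

Lemma is_derive_Rplus (f g : R -> R) (x f' g' : R) :
  is_derive f x f' -> is_derive g x g' -> is_derive (fun t => f t + g t) x (f' + g').
Proof. exact (is_derive_plus f g x f' g'). Qed.

Lemma is_derive_Rscal (f : R -> R) (c x f' : R) :
  is_derive f x f' -> is_derive (fun t => c * f t) x (c * f').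
Proof. exact (is_derive_scal f x c f'). Qed.

Lemma is_derive_Rext (f h : R -> R) (x l : R) :
  (forall t, f t = h t) -> is_derive f x l -> is_derive h x l.
Proof. exact (is_derive_ext f h x l). Qed.

Lemma is_derive_eq (f : R -> R) (x l l' : R) : is_derive f x l -> l = l' -> is_derive f x l'.
Proof. intros H <-; exact H. Qed.

(** The Leibniz rule for t G(t) has two terms only. At n = 0 the truncated index [n - 1] is harmless
    because of the factor [INR 0]. *)
Lemma jet_id_mul (G : nat -> R -> R) (D : R -> Prop) :
  jet D G -> jet D (fun n t => INR n * G (n - 1)%nat t + t * G n t).
Proof.
intros HG n x Hx; eapply is_derive_eq.
- apply is_derive_Rplus.
  + apply (is_derive_Rscal (G (n - 1)%nat)), HG, Hx.
  + apply is_derive_Rmult; [apply: is_derive_id|apply HG, Hx].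
- destruct n as [|n]; [simpl; rewrite /one /=; ring|].
  replace (S n - 1)%nat with n by lia; replace (S (S n) - 1)%nat with (S n) by lia.
  rewrite !S_INR /one /=; ring.
Qed.

(** The Leibniz expansion of the n-th derivative of a product. *)
Definition jmul (F G : nat -> R -> R) (n : nat) (x : R) : R :=
  sum_f_R0 (fun i => Binomial.C n i * (F i x * G (n - i)%nat x)) n.

Lemma C_n_0 n : Binomial.C n 0 = 1.
Proof. unfold Binomial.C; rewrite Nat.sub_0_r; simpl; field; apply INR_fact_neq_0. Qed.

Lemma C_n_n n : Binomial.C n n = 1.
Proof. unfold Binomial.C; rewrite Nat.sub_diag; simpl; field; apply INR_fact_neq_0. Qed.

(** Pascal's rule in the shape produced by differentiating the Leibniz sum: [T i] stands for F^(i)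
    G^(n+1-i), and each product of order n contributes two neighbours. *)
Lemma sum_pascal (T : nat -> R) n :
  sum_f_R0 (fun i => Binomial.C (S n) i * T i) (S n) =
  sum_f_R0 (fun i => Binomial.C n i * (T (S i) + T i)) n.
Proof.
destruct n as [|n].
{ simpl; rewrite !C_n_0 C_n_n; ring. }
rewrite decomp_sum; [|lia]; simpl Nat.pred.
rewrite tech5 C_n_0 C_n_n.
rewrite (sum_eq (fun i => Binomial.C (S n) i * (T (S i) + T i))
  (fun i => Binomial.C (S n) i * T (S i) + Binomial.C (S n) i * T i)); [|intros; ring].
rewrite sum_plus tech5 (decomp_sum (fun i => Binomial.C (S n) i * T i)); [|lia].
simpl Nat.pred; rewrite C_n_0 C_n_n.
rewrite (sum_eq (fun i => Binomial.C (S (S n)) (S i) * T (S i))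
  (fun i => Binomial.C (S n) i * T (S i) + Binomial.C (S n) (S i) * T (S i))).
2:{ intros i Hi; rewrite -pascal; [ring|lia]. }
rewrite sum_plus; ring.
Qed.

Lemma is_derive_sum_f_R0 (f : nat -> R -> R) (l : nat -> R) n x :
  (forall i, (i <= n)%nat -> is_derive (f i) x (l i)) ->
  is_derive (fun y => sum_f_R0 (fun i => f i y) n) x (sum_f_R0 l n).
Proof.
induction n as [|n IH]; intros H; simpl; [apply H; auto|].
apply (is_derive_Rplus (fun y => sum_f_R0 (fun i => f i y) n)); auto.
Qed.

Lemma jet_mul (D : R -> Prop) (F G : nat -> R -> R) :
  jet D F -> jet D G -> jet D (jmul F G).
Proof.
intros HF HG n x Hx; unfold jmul.
rewrite sum_pascal.
apply (is_derive_sum_f_R0 (fun i y => Binomial.C n i * (F i y * G (n - i)%nat y))).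
intros i Hi; apply (is_derive_Rscal (fun y => F i y * G (n - i)%nat y)).
replace (S n - S i)%nat with (n - i)%nat by lia.
replace (S n - i)%nat with (S (n - i)) by lia.
apply is_derive_Rmult; auto.
Qed.

(** Recursion through [Derive f], rather than differentiating an n-th derivative, lets the rules for
    sums, products and inverses be proved by induction on the order for all functions at once. *)
Fixpoint Cn (n : nat) (f : R -> R) : Prop :=
  match n with
  | O => True
  | S m => (forall x, ex_derive f x) /\ Cn m (Derive f)
  end.

Lemma Cn_ext n : forall f g, (forall x, f x = g x) -> Cn n f -> Cn n g.
Proof.
induction n as [|n IH]; intros f g H; [trivial|intros [H1 H2]; split].
- intros x; exact (ex_derive_ext f g x H (H1 x)).
- apply (IH (Derive f)); auto; intros x; apply Derive_ext, H.
Qed.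

Lemma Cn_S n : forall f, Cn (S n) f -> Cn n f.
Proof.
induction n as [|n IH]; intros f; [exact (fun _ => I)|intros [H1 H2]; split; auto].
Qed.

Lemma Cn_plus n : forall f g, Cn n f -> Cn n g -> Cn n (fun x => f x + g x).
Proof.
induction n as [|n IH]; intros f g; [trivial|intros [F1 F2] [G1 G2]; split].
- intros x; apply: ex_derive_plus; auto.
- apply (Cn_ext n (fun x => Derive f x + Derive g x)); auto.
  intros x; rewrite Derive_plus; auto.
Qed.

Lemma Cn_mult n : forall f g, Cn n f -> Cn n g -> Cn n (fun x => f x * g x).
Proof.
induction n as [|n IH]; intros f g; [trivial|intros F G].
pose proof (Cn_S _ _ F); pose proof (Cn_S _ _ G).
destruct F as [F1 F2]; destruct G as [G1 G2]; split.
- intros x; apply: ex_derive_mult; auto.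
- apply (Cn_ext n (fun x => Derive f x * g x + f x * Derive g x)).
  + intros x; rewrite Derive_mult; auto.
  + apply Cn_plus; auto.
Qed.

(** (1/f)' = - f' (1/f)^2 involves only 1/f itself, which the induction hypothesis covers at the
    lower order. *)
Lemma Cn_inv n f : (forall x, f x <> 0) -> Cn n f -> Cn n (fun x => / f x).
Proof.
intros Hf; induction n as [|n IH]; [trivial|intros F].
pose proof (IH (Cn_S _ _ F)) as Hi; destruct F as [F1 F2]; split.
- intros x; apply ex_derive_inv; auto.
- apply (Cn_ext n (fun x => Derive f x * ((fun _ => -1) x * (/ f x * / f x)))).
  + intros x; rewrite Derive_inv; auto; field; auto.
  + apply Cn_mult; auto; apply Cn_mult; [|apply Cn_mult; auto].
    clear; generalize (-1); induction n as [|n IH]; intros c; [exact I|split].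
    * intros x; apply ex_derive_const.
    * apply (Cn_ext n (fun _ => 0)); auto; intros x; rewrite Derive_const; auto.
Qed.

Lemma Cn_PSeries n : forall a, CV_radius a = p_infty -> Cn n (PSeries a).
Proof.
induction n as [|n IH]; intros a Ha; [exact I|split].
- intros x; apply ex_derive_PSeries; rewrite Ha; exact I.
- apply (Cn_ext n (PSeries (PS_derive a))).
  + intros x; rewrite Derive_PSeries; auto; rewrite Ha; exact I.
  + apply IH; rewrite CV_radius_derive; auto.
Qed.

Lemma Cn_ex_derive n : forall f, Cn (S n) f -> forall x, ex_derive (Derive_n f n) x.
Proof.
induction n as [|n IH]; intros f [H1 H2]; [exact H1|].
intros x; apply ex_derive_ext with (Derive_n (Derive f) n); [|apply IH, H2].
intros t; change (Derive_n (Derive_n f 1) n t = Derive_n f (S n) t).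
rewrite Derive_n_comp Nat.add_1_r; auto.
Qed.

Lemma Cn_jet f : (forall n, Cn n f) -> jet (fun _ => True) (Derive_n f).
Proof. intros H n x _; apply Derive_correct, Cn_ex_derive, H. Qed.

(* The power series of (e^x - 1)/x and of ((e^x - 1)/x - 1)/x. *)
Definition expd1 : R -> R := PSeries (PS_decr_1 (fun n => / INR (Factorial.fact n))).
Definition expd2 : R -> R :=
  PSeries (PS_decr_1 (PS_decr_1 (fun n => / INR (Factorial.fact n)))).

Lemma CV_radius_exp : CV_radius (fun n => / INR (Factorial.fact n)) = p_infty.
Proof.
apply CV_radius_infinite_DAlembert.
- intros n; apply Rinv_neq_0_compat, INR_fact_neq_0.
- apply is_lim_seq_ext with (fun n => / INR (S n)).
  + intros n; rewrite fact_simpl mult_INR.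
    rewrite Rabs_pos_eq.
    * field; split; [apply INR_fact_neq_0|apply not_0_INR; lia].
    * apply Rlt_le, Rdiv_lt_0_compat; apply Rinv_0_lt_compat.
      -- apply Rmult_lt_0_compat; [apply lt_0_INR; lia|apply INR_fact_lt_0].
      -- apply INR_fact_lt_0.
  + apply (is_lim_seq_incr_1 (fun n => / INR n)).
    apply (is_lim_seq_inv INR p_infty); [apply is_lim_seq_INR|discriminate].
Qed.

Lemma expd1_exp x : x * expd1 x = exp x - 1.
Proof.
rewrite exp_Reals PSeries_decr_1; [|exists (exp x); apply is_exp_Reals].
unfold expd1; simpl; field.
Qed.

Lemma expd2_expd1 x : x * expd2 x = expd1 x - 1.
Proof.
unfold expd1; rewrite PSeries_decr_1.
- unfold expd2, PS_decr_1 at 3; simpl; field.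
- apply CV_radius_inside; rewrite CV_radius_decr_1 CV_radius_exp; exact I.
Qed.

Lemma expd1_neq_0 x : expd1 x <> 0.
Proof.
destruct (Req_dec x 0) as [->|Hx].
- pose proof (expd2_expd1 0); lra.
- intros H; pose proof (expd1_exp x) as E; rewrite H Rmult_0_r in E.
  apply Hx, exp_inv; rewrite exp_0; lra.
Qed.

Lemma bern_gen_expd1 x : bern_gen x = / expd1 x.
Proof.
unfold bern_gen; destruct (Req_EM_T x 0) as [->|Hx].
- pose proof (expd2_expd1 0); replace (expd1 0) with 1 by lra; field.
- rewrite -expd1_exp; field; split; auto; apply expd1_neq_0.
Qed.

(** 1/x - 1/(e^x - 1) = (e^x - 1 - x) / (x (e^x - 1)); cancelling x^2 against x^2 leaves a quotient
    of entire series whose denominator has no real zero, so smoothness at 0 requires no limit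
    argument. *)
Definition p (x : R) : R := expd2 x * / expd1 x.

Lemma p_phi x : 0 < x -> p x = phi x.
Proof.
intros Hx; unfold p, phi; rewrite -expd1_exp.
pose proof (expd2_expd1 x); pose proof (expd1_neq_0 x).
replace (expd2 x) with ((expd1 x - 1) / x) by (apply Rmult_eq_reg_l with x; [field_simplify; lra|lra]).
field; lra.
Qed.

Lemma expd2_0 : expd2 0 = / 2.
Proof. unfold expd2; rewrite PSeries_0; unfold PS_decr_1; simpl; f_equal; ring. Qed.

Lemma p_0 : p 0 = / 2.
Proof.
unfold p; pose proof (expd2_expd1 0); replace (expd1 0) with 1 by lra; rewrite expd2_0; field.
Qed.

Lemma Cn_expd1 n : Cn n expd1.
Proof. apply Cn_PSeries; rewrite CV_radius_decr_1; apply CV_radius_exp. Qed.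

Lemma jet_p : jet (fun _ => True) (Derive_n p).
Proof.
apply Cn_jet; intros n; apply Cn_mult.
- apply Cn_PSeries; rewrite !CV_radius_decr_1; apply CV_radius_exp.
- apply Cn_inv; [apply expd1_neq_0|apply Cn_expd1].
Qed.

Lemma jet_bern : jet (fun _ => True) (Derive_n bern_gen).
Proof.
apply Cn_jet; intros n; apply (Cn_ext n (fun x => / expd1 x)).
- intros x; rewrite bern_gen_expd1; auto.
- apply Cn_inv; [apply expd1_neq_0|apply Cn_expd1].
Qed.

(** * Size of the derivatives of p and g *)

Notation fct n := (INR (Factorial.fact n)).

Definition g (x : R) : R := / (exp x - 1).
Definition P (m : nat) (x : R) : R := Derive_n p m x.
Definition z (m : nat) (x : R) : R := (-1) ^ m * (x ^ m * P m x) / fct m.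
Definition q (m : nat) (x : R) : R := / x - z m x.
(* For x > 0 this is the m-th derivative of g. *)
Definition G (m : nat) (x : R) : R := (-1) ^ m * fct m / x ^ S m - P m x.

Lemma pow_minus_1_sqr n : (-1) ^ n * (-1) ^ n = 1.
Proof. rewrite -Rpow_mult_distr; replace (-1 * -1) with 1 by ring; apply pow1. Qed.

Lemma exp_gt_1 x : 0 < x -> 1 < exp x.
Proof. intros Hx; rewrite -exp_0; apply exp_increasing, Hx. Qed.

Lemma is_derive_P m x : is_derive (P m) x (P (S m) x).
Proof. exact (jet_p m x I). Qed.

Lemma continuous_P m x : continuous (P m) x.
Proof. apply: ex_derive_continuous; exists (P (S m) x); apply is_derive_P. Qed.

Lemma jet_G : jet (fun x => 0 < x) G.
Proof.
intros n x Hx; unfold G; eapply is_derive_eq.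
- apply (is_derive_Rplus (fun y => (-1) ^ n * fct n / y ^ S n) (fun y => - P n y)).
  + apply (is_derive_Rscal (fun y => / y ^ S n)).
    apply (is_derive_inv (fun y => y ^ S n)); [auto_derive; [exact I|reflexivity]|].
    apply pow_nonzero; lra.
  + apply: is_derive_opp; apply is_derive_P.
- assert (x ^ n <> 0) by (apply pow_nonzero; lra).
  rewrite fact_simpl mult_INR; unfold opp; cbn -[pow INR Factorial.fact].
  destruct n; simpl; field; repeat split; try apply pow_nonzero; lra.
Qed.

Lemma G_0 x : 0 < x -> G 0 x = g x.
Proof.
intros Hx; unfold G, P; rewrite /Derive_n p_phi //; unfold phi, g.
pose proof (exp_gt_1 x Hx); simpl; field; lra.
Qed.

Lemma G_q m x : 0 < x -> G m x = (-1) ^ m * fct m / x ^ m * q m x.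
Proof.
intros Hx; unfold G, q, z.
pose proof (pow_minus_1_sqr m) as H.
assert (x ^ m <> 0) by (apply pow_nonzero; lra).
replace (P m x) with ((-1) ^ m * (-1) ^ m * P m x) at 1 by (rewrite H; ring).
simpl; field; repeat split; auto; [apply INR_fact_neq_0|lra].
Qed.

Lemma q_G m x : 0 < x -> q m x = (-1) ^ m * x ^ m * G m x / fct m.
Proof.
intros Hx; rewrite G_q //.
pose proof (pow_minus_1_sqr m) as H.
assert (x ^ m <> 0) by (apply pow_nonzero; lra).
transitivity ((-1) ^ m * (-1) ^ m * q m x); [rewrite H; ring|].
field; split; auto; apply INR_fact_neq_0.
Qed.

(* The Leibniz expansion of the derivatives of the equation g' = -g - g^2. *)
Lemma g_sqr_derive n x : 0 < x -> G (S n) x = - G n x - jmul G G n x.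
Proof.
revert n x; apply jet_eq; [apply open_pos| | |].
- intros n x Hx; apply (jet_G (S n) x Hx).
- intros n x Hx; eapply is_derive_eq.
  + apply (is_derive_Rplus (fun y => - G n y) (fun y => - jmul G G n y)).
    * apply: is_derive_opp; apply jet_G, Hx.
    * apply: is_derive_opp; apply (jet_mul _ _ _ jet_G jet_G n x Hx).
  + reflexivity.
- intros x Hx; unfold jmul; simpl sum_f_R0; rewrite C_n_0 G_0 //.
  rewrite -(is_derive_unique _ _ _ (jet_G O x Hx)) (Derive_ext_loc (G 0) g).
  2:{ generalize (open_pos x Hx); apply filter_imp; apply G_0. }
  apply is_derive_unique; unfold g; pose proof (exp_gt_1 x Hx).
  auto_derive; [lra|field; lra].
Qed.

(** Each term of the recurrence from g' = -g - g^2 contains a factor of lower order, so the decay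
    e^(-x) is inherited. The bound is uniform in i <= n because the Leibniz sum involves all lower
    derivatives. *)
Lemma G_exp_bound n : exists K, 0 <= K /\ forall i x, (i <= n)%nat -> 1 <= x -> Rabs (G i x) <= K * exp (- x).
Proof.
induction n as [|n [K [HK H]]].
(* For x >= 1 one has e^x >= 2, hence e^x <= 2 (e^x - 1). *)
- exists 2; split; [lra|]; intros i x Hi Hx; replace i with O by lia.
  rewrite G_0; [|lra]; unfold g; rewrite exp_Ropp.
  assert (2 <= exp x).
  { generalize (exp_ineq1_le x); lra. }
  rewrite Rabs_pos_eq; [|apply Rlt_le, Rinv_0_lt_compat; lra].
  apply Rmult_le_reg_r with ((exp x - 1) * exp x); [nra|]; field_simplify; lra.
- exists (K + K * K * sum_f_R0 (Binomial.C n) n).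
  assert (HS : 0 <= sum_f_R0 (Binomial.C n) n).
  { apply cond_pos_sum; intros i; unfold Binomial.C.
    apply Rlt_le, Rdiv_lt_0_compat; [apply INR_fact_lt_0|].
    apply Rmult_lt_0_compat; apply INR_fact_lt_0. }
  split; [assert (0 <= K * K) by nra; nra|].
  intros i x Hi Hx; destruct (Nat.eq_dec i (S n)) as [->|Hi'].
  2:{ eapply Rle_trans; [apply H; auto; lia|].
      apply Rmult_le_compat_r; [apply Rlt_le, exp_pos|assert (0 <= K * K) by nra; nra]. }
  rewrite g_sqr_derive; [|lra].
  unfold Rminus; eapply Rle_trans; [apply Rabs_triang|]; rewrite !Rabs_Ropp.
  rewrite Rmult_plus_distr_r; apply Rplus_le_compat; [apply H; auto|].
  unfold jmul; eapply Rle_trans; [apply Rsum_abs|].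
  rewrite Rmult_assoc (Rmult_comm _ (exp (-x))) -Rmult_assoc scal_sum; apply sum_Rle.
  intros j Hj; rewrite Rabs_mult (Rabs_mult (G j x)).
  assert (HC : 0 <= Binomial.C n j).
  { unfold Binomial.C; apply Rlt_le, Rdiv_lt_0_compat; [apply INR_fact_lt_0|].
    apply Rmult_lt_0_compat; apply INR_fact_lt_0. }
  rewrite (Rabs_pos_eq (Binomial.C n j)) //; apply Rmult_le_compat_l; auto.
  assert (He : exp (- x) <= 1) by (rewrite -exp_0; apply Rlt_le, exp_increasing; lra).
  pose proof (exp_pos (- x)).
  apply Rle_trans with ((K * exp (- x)) * (K * exp (- x))).
  + apply Rmult_le_compat; auto using Rabs_pos; apply H; auto; lia.
  + assert (0 <= K * K) by nra.
    replace (K * exp (- x) * (K * exp (- x))) with (K * K * exp (-x) * exp (-x)) by ring.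
    rewrite -{2}(Rmult_1_r (K * K * exp (- x))); apply Rmult_le_compat_l; auto.
    apply Rmult_le_pos; lra.
Qed.

(** Halving the argument splits e^x into e^(x/2) e^(x/2): one factor absorbs (x/2)^n by induction,
    the other absorbs x/2. *)
Lemma pow_exp_bound n : exists K, forall x, 0 <= x -> x ^ n <= K * exp x.
Proof.
induction n as [|n [K H]].
- exists 1; intros x Hx; simpl; generalize (exp_ineq1_le x); lra.
- exists (2 ^ S n * K); intros x Hx.
  replace (x ^ S n) with (2 ^ S n * ((x / 2) ^ n * (x / 2))).
  2:{ replace ((x / 2) ^ n * (x / 2)) with ((x / 2) ^ S n) by (simpl; ring).
      rewrite -Rpow_mult_distr; f_equal; field. }
  rewrite Rmult_assoc; apply Rmult_le_compat_l; [apply pow_le; lra|].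
  replace x with (x / 2 + x / 2) at 3 by field.
  rewrite exp_plus -Rmult_assoc; apply Rmult_le_compat; try lra.
  + apply pow_le; lra.
  + apply H; lra.
  + generalize (exp_ineq1_le (x / 2)); lra.
Qed.

(** Up to sign [q m] is x^m g^(m) / m!, and the exponential decay of g^(m) beats every power. *)
Lemma q_decay a m : exists K, forall x, 1 <= x -> Rabs (x ^ a * q m x) <= K.
Proof.
destruct (G_exp_bound m) as [K [HK H]]; destruct (pow_exp_bound (a + m)) as [L HL].
exists (L * K / fct m); intros x Hx; rewrite q_G; [|lra].
replace (x ^ a * ((-1) ^ m * x ^ m * G m x / fct m)) with
  ((-1) ^ m * (x ^ (a + m) * G m x / fct m)) by (rewrite pow_add; field; apply INR_fact_neq_0).
rewrite Rabs_mult pow_1_abs Rmult_1_l.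
unfold Rdiv; rewrite !Rabs_mult (Rabs_pos_eq (/ fct m)); [|apply Rlt_le, Rinv_0_lt_compat, INR_fact_lt_0].
apply Rmult_le_compat_r; [apply Rlt_le, Rinv_0_lt_compat, INR_fact_lt_0|].
assert (0 <= x ^ (a + m)) by (apply pow_le; lra).
rewrite (Rabs_pos_eq (x ^ (a + m))) //.
eapply Rle_trans.
- apply Rmult_le_compat; [auto|apply Rabs_pos|apply HL; lra|apply H; auto].
- right; rewrite exp_Ropp; field; generalize (exp_pos x); lra.
Qed.

Lemma is_lim_0_bound (f : R -> R) K :
  (forall x, 1 <= x -> Rabs (f x) <= K / (1 + x)) -> is_lim f p_infty 0.
Proof.
intros H; apply (is_lim_le_le_loc (fun x => (- K) / (1 + x)) (fun x => K / (1 + x)));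
  try apply is_lim_inv_p.
exists 1; intros x Hx; specialize (H x (Rlt_le _ _ Hx)); apply Rabs_le_between in H.
unfold Rdiv in *; lra.
Qed.

Lemma q_lim a m : is_lim (fun x => x ^ a * q m x) p_infty 0.
Proof.
destruct (q_decay (S a) m) as [K HK]; apply (is_lim_0_bound _ (2 * K)); intros x Hx.
specialize (HK x Hx); simpl in HK; rewrite Rmult_assoc Rabs_mult (Rabs_pos_eq x) in HK; [|lra].
apply le_div; [lra|].
generalize (Rabs_pos (x ^ a * q m x)); nra.
Qed.

Lemma continuous_z m x : continuous (z m) x.
Proof.
apply: ex_derive_continuous; unfold z; eexists.
apply (is_derive_Rext (fun x => (-1) ^ m / fct m * (x ^ m * P m x))).
{ intros t; rewrite /Rdiv; ring. }
apply is_derive_Rscal, is_derive_Rmult; [|apply is_derive_P].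
auto_derive; [exact I|reflexivity].
Qed.

(** The Euler operator x d/dx maps z_m to m z_m - (m+1) z_{m+1}; this makes combinations of
    neighbouring [z] exact derivatives. *)
Lemma is_derive_z m x : 0 < x ->
  is_derive (z m) x ((INR m * z m x - INR (S m) * z (S m) x) / x).
Proof.
intros Hx; unfold z.
apply (is_derive_Rext (fun x => (-1) ^ m / fct m * (x ^ m * P m x))).
{ intros t; rewrite /Rdiv; ring. }
eapply is_derive_eq.
- apply is_derive_Rscal, is_derive_Rmult; [|apply is_derive_P].
  auto_derive; [exact I|reflexivity].
- rewrite fact_simpl mult_INR.
  pose proof (INR_fact_neq_0 m); assert (INR (S m) <> 0) by (apply not_0_INR; lia).
  destruct m; [simpl; field; lra|simpl pow; simpl Nat.pred; field].
  repeat split; auto; lra.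
Qed.

Lemma z_0_0 : z 0 0 = / 2.
Proof. unfold z, P; simpl; rewrite p_0; field. Qed.

Lemma z_0_x x : z 0 x = p x.
Proof. unfold z, P; simpl; field. Qed.

Lemma z_S_0 m : z (S m) 0 = 0.
Proof. unfold z; simpl; field; apply (INR_fact_neq_0 (S m)). Qed.

Lemma z_right m : filterlim (z m) (at_right 0) (locally (z m 0)).
Proof. apply continuous_right_limit; auto; apply continuous_z. Qed.

(** Compactness handles [0, 1]; beyond 1, x z_m = 1 - x q_m is bounded. A product of two such
    functions is therefore integrable. *)
Lemma z_bound m : exists K, 0 <= K /\ forall x, 0 < x -> Rabs (z m x) <= K / (1 + x).
Proof.
destruct (continuity_ab_maj (fun x => Rabs (z m x)) 0 1) as [M [HM _]]; [lra| |].
{ intros c _; apply continuity_pt_filterlim.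
  apply (continuous_comp (z m) Rabs); [apply continuous_z|apply: continuous_Rabs]. }
destruct (q_decay 1 m) as [K HK].
assert (0 <= K) by (eapply Rle_trans; [apply Rabs_pos|apply (HK 1); lra]).
pose proof (Rabs_pos (z m M)).
exists (2 * Rabs (z m M) + 2 * (1 + K)); split; [lra|].
intros x Hx; apply le_div; [lra|].
pose proof (Rabs_pos (z m x)).
destruct (Rle_dec x 1) as [Hx1|Hx1].
- specialize (HM x); simpl in HM; assert (H2 : 0 <= x <= 1) by lra.
  specialize (HM H2); nra.
- assert (H2 : 1 <= x) by lra; specialize (HK x H2); rewrite pow_1 in HK.
  assert (E : x * z m x = 1 - x * q m x) by (unfold q; field; lra).
  assert (E2 : Rabs (x * z m x) <= 1 + K).
  { rewrite E; unfold Rminus; eapply Rle_trans; [apply Rabs_triang|].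
    rewrite Rabs_R1 Rabs_Ropp; lra. }
  rewrite Rabs_mult (Rabs_pos_eq x) in E2; [|lra]; nra.
Qed.

Lemma z_lim m : is_lim (z m) p_infty 0.
Proof.
destruct (z_bound m) as [K [_ HK]]; apply (is_lim_0_bound _ K); intros; apply HK; lra.
Qed.

(** * Elementary integrals *)

Lemma continuous_Rmult (f h : R -> R) x :
  continuous f x -> continuous h x -> continuous (fun y => f y * h y) x.
Proof. exact (continuous_mult f h x). Qed.

Lemma continuous_Rminus (f h : R -> R) x :
  continuous f x -> continuous h x -> continuous (fun y => f y - h y) x.
Proof. exact (continuous_minus f h x). Qed.

Lemma continuous_pow n x : continuous (fun y => y ^ n) x.
Proof. apply (ex_derive_continuous (fun y => y ^ n)); auto_derive; exact I. Qed.

Lemma continuous_q m x : 0 < x -> continuous (q m) x.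
Proof.
intros Hx; apply continuous_Rminus; [apply continuous_Rinv, Rgt_not_eq, Hx|apply continuous_z].
Qed.

Lemma is_int_P_1 : is_int (P 1) (- / 2).
Proof.
apply is_int_eq with (0 - z 0 0); [|rewrite z_0_0; ring].
apply is_int_FTC with (z 0); [| |apply z_right|apply z_lim].
- intros x _; apply (is_derive_Rext (P 0)); [intros t; symmetry; apply z_0_x|apply is_derive_P].
- intros x _; apply continuous_P.
Qed.

Lemma z_S_right k : filterlim (z (S k)) (at_right 0) (locally 0).
Proof. pose proof (z_right (S k)) as H; rewrite z_S_0 in H; exact H. Qed.

(** [z (S k)] vanishes at both ends, so its derivative integrates to 0: the integrals of (k+1)
    z_{k+1}/x and (k+2) z_{k+2}/x agree. The base case is z_1/x = -p'. *)
Lemma is_int_z_div k : is_int (fun x => z (S k) x / x) (/ (2 * INR (S k))).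
Proof.
induction k as [|k IH].
- apply is_int_eq with (-1 * - / 2); [|simpl; field].
  eapply is_int_ext; [|apply is_int_scal, is_int_P_1].
  intros x Hx; unfold z; simpl; field; lra.
- assert (H : is_int (fun x => (INR (S k) * z (S k) x - INR (S (S k)) * z (S (S k)) x) / x) (0 - 0)).
  { apply is_int_FTC with (z (S k)); [| |apply z_S_right|apply z_lim].
    - apply is_derive_z.
    - intros x Hx; apply continuous_Rmult; [|apply continuous_Rinv, Rgt_not_eq, Hx].
      apply continuous_Rminus; apply continuous_Rmult;
       (apply continuous_const || apply continuous_z). }
  assert (INR (S k) <> 0) by (apply not_0_INR; lia).
  assert (INR (S (S k)) <> 0) by (apply not_0_INR; lia).
  pose proof (is_int_plus _ _ _ _ (is_int_scal _ (- / INR (S (S k))) _ H)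
    (is_int_scal _ (INR (S k) / INR (S (S k))) _ IH)) as E.
  eapply is_int_eq; [eapply is_int_ext; [|exact E]|].
  + intros x Hx; cbv beta; field; split; auto; lra.
  + field; auto.
Qed.

Lemma is_derive_Rpow n x : is_derive (fun y => y ^ n) x (INR n * x ^ pred n).
Proof. auto_derive; [exact I|ring]. Qed.

(** For a = 0 the boundary value at 0 gives the integral of q_m - q_{m+1}; for a > 0 both boundary
    values vanish and a recurrence in m for the Mellin integrals results. *)
Lemma is_derive_pow_q a m x : 0 < x ->
  is_derive (fun x => x ^ S a * q m x) x
    (x ^ a * (INR (S a + m) * q m x - INR (S m) * q (S m) x)).
Proof.
intros Hx; eapply is_derive_eq.
- apply is_derive_Rmult; [apply is_derive_Rpow|].
  unfold q; apply (is_derive_Rplus (fun y => / y) (fun y => - z m y)).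
  + auto_derive; [lra|reflexivity].
  + apply: is_derive_opp; apply is_derive_z, Hx.
- unfold q; change (@opp R_NormedModule) with Ropp.
  rewrite plus_INR !S_INR; simpl pow; simpl Nat.pred; field; lra.
Qed.

Lemma continuous_pow_q a m x c d : 0 < x ->
  continuous (fun x => x ^ a * (c * q m x - d * q (S m) x)) x.
Proof.
intros Hx; apply continuous_Rmult; [apply continuous_pow|].
apply continuous_Rminus; apply continuous_Rmult;
  (apply continuous_const || apply continuous_q, Hx).
Qed.

(** The convention [0 ^ 0 = 1] covers in one statement the pole of [q] for a = 0 and the limit 0 for
    a > 0. *)
Lemma right_pow_q a m : filterlim (fun x => x ^ S a * q m x) (at_right 0) (locally (0 ^ a)).
Proof.
apply filterlim_right_ext with (fun x => x ^ a - x ^ S a * z m x).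
{ intros x Hx; unfold q; simpl; field; lra. }
apply continuous_right_limit; [|simpl; ring].
apply continuous_Rminus; [apply continuous_pow|].
apply continuous_Rmult; [apply continuous_pow|apply continuous_z].
Qed.

Lemma is_int_q_diff m : is_int (fun x => q m x - q (S m) x) (- / INR (S m)).
Proof.
assert (INR (S m) <> 0) by (apply not_0_INR; lia).
assert (E : is_int (fun x => x ^ 0 * (INR (1 + m) * q m x - INR (S m) * q (S m) x)) (0 - 0 ^ 0)).
{ apply is_int_FTC with (fun x => x ^ 1 * q m x).
  - intros x Hx; apply (is_derive_pow_q 0 m x Hx).
  - intros x Hx; apply continuous_pow_q, Hx.
  - apply right_pow_q.
  - apply q_lim. }
apply (is_int_scal _ (/ INR (S m))) in E.
eapply is_int_eq; [eapply is_int_ext; [|exact E]|].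
- intros x Hx; cbn -[INR]; field; auto.
- cbn -[INR]; field; auto.
Qed.

Lemma is_int_q_0k k : is_int (fun x => q 0 x - q k x) (- harmonic k).
Proof.
induction k as [|k IH].
- apply is_int_eq with (0 * - / INR 1); [|simpl; ring].
  eapply is_int_ext; [|apply is_int_scal, is_int_q_diff].
  intros x _; cbv beta; ring.
- eapply is_int_eq; [eapply is_int_ext; [|exact (is_int_plus _ _ _ _ IH (is_int_q_diff k))]|].
  + intros x _; cbv beta; ring.
  + cbn -[INR]; ring.
Qed.

Lemma is_lim_pow_exp a c : 0 < c -> is_lim (fun x => x ^ a * exp (- (c * x))) p_infty 0.
Proof.
intros Hc; destruct (pow_exp_bound (S a)) as [K HK].
apply (is_lim_0_bound _ (2 * (K / c ^ S a))); intros x Hx.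
specialize (HK (c * x)); assert (Hcx : 0 <= c * x) by nra; specialize (HK Hcx).
assert (0 < c ^ S a) by (apply pow_lt; auto).
assert (0 <= x ^ a) by (apply pow_le; lra).
pose proof (exp_pos (- (c * x))).
rewrite Rabs_pos_eq; [|apply Rmult_le_pos; lra].
assert (B : x * (x ^ a * exp (- (c * x))) <= K / c ^ S a).
{ rewrite Rpow_mult_distr in HK.
  apply Rmult_le_reg_r with (c ^ S a * exp (c * x)); [apply Rmult_lt_0_compat; auto; apply exp_pos|].
  replace (K / c ^ S a * (c ^ S a * exp (c * x))) with (K * exp (c * x)) by (field; lra).
  eapply Rle_trans; [right|exact HK].
  rewrite exp_Ropp; simpl; field; generalize (exp_pos (c * x)); lra. }
assert (D : 0 <= x ^ a * exp (- (c * x))) by (apply Rmult_le_pos; lra).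
apply le_div; [lra|].
apply Rle_trans with (2 * (x * (x ^ a * exp (- (c * x))))); [|lra].
assert (0 <= (x - 1) * (x ^ a * exp (- (c * x)))) by (apply Rmult_le_pos; lra).
lra.
Qed.

Lemma is_int_pow_exp a c : 0 < c ->
  is_int (fun x => x ^ a * exp (- (c * x))) (fct a / c ^ S a).
Proof.
intros Hc; induction a as [|a IH].
- apply is_int_eq with (0 - - / c); [|simpl; field; lra].
  apply is_int_FTC with (fun x => - / c * exp (- (c * x))).
  + intros x Hx; auto_derive; [exact I|simpl; field; lra].
  + intros x Hx; apply: ex_derive_continuous; auto_derive; exact I.
  + apply continuous_right_limit; [|rewrite Rmult_0_r Ropp_0 exp_0; ring].
    apply: ex_derive_continuous; auto_derive; exact I.
  + replace (Finite 0) with (Rbar_mult (- / c) 0) by (simpl; f_equal; ring).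
    apply (is_lim_scal_l (fun x => exp (- (c * x))) (- / c) p_infty 0).
    eapply is_lim_ext; [|apply (is_lim_pow_exp 0 c Hc)]; intros; simpl; ring.
- assert (H : is_int (fun x => x ^ S a * exp (- (c * x)) - INR (S a) / c * (x ^ a * exp (- (c * x)))) (0 - 0)).
  { apply is_int_FTC with (fun x => - / c * (x ^ S a * exp (- (c * x)))).
    - intros x Hx; eapply is_derive_eq.
      + apply is_derive_Rscal, is_derive_Rmult; [apply is_derive_Rpow|].
        auto_derive; [exact I|reflexivity].
      + simpl Nat.pred; cbv beta; simpl pow; field; lra.
    - intros x Hx; apply: ex_derive_continuous; auto_derive; exact I.
    - apply continuous_right_limit; [|simpl; ring].
      apply: ex_derive_continuous; auto_derive; exact I.
    - replace (Finite 0) with (Rbar_mult (- / c) 0) by (simpl; f_equal; ring).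
      apply (is_lim_scal_l (fun x => x ^ S a * exp (- (c * x))) (- / c) p_infty 0).
      apply is_lim_pow_exp, Hc. }
  pose proof (is_int_plus _ _ _ _ H (is_int_scal _ (INR (S a) / c) _ IH)) as E.
  eapply is_int_eq; [eapply is_int_ext; [|exact E]|].
  + intros x Hx; cbv beta; ring.
  + rewrite fact_simpl mult_INR; simpl pow; field; split; [apply pow_nonzero|]; lra.
Qed.

Lemma is_int_exp c : 0 < c -> is_int (fun x => exp (- (c * x))) (/ c).
Proof.
intros Hc; eapply is_int_eq; [eapply is_int_ext; [|apply (is_int_pow_exp 0 c Hc)]|].
- intros x _; simpl; ring.
- simpl; field; lra.
Qed.

(** The discarded part is the integral of f(x) e^(-Nx), at most c/N in absolute value because |f| <=
    c. *)
Lemma lim_truncated_int (f : R -> R) c L (s : nat -> R) :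
  (forall x, 0 < x -> Rabs (f x) <= c / (1 + x) ^ 2) ->
  is_int f L ->
  (forall N, is_int (fun x => f x * (1 - exp (- (INR N * x)))) (s N)) ->
  is_lim_seq s L.
Proof.
intros Hf HL Hs.
assert (Hc : 0 <= c).
{ specialize (Hf 1 Rlt_0_1); pose proof (Rabs_pos (f 1)); lra. }
apply is_lim_seq_le_le_loc with (fun n => L - c * / INR n) (fun n => L + c * / INR n).
- exists 1%nat; intros N HN.
  assert (HN' : 0 < INR N) by (apply lt_0_INR; lia).
  assert (B : Rabs (L + -1 * s N) <= c * / INR N).
  { eapply is_int_bound; [|exact (is_int_plus _ _ _ _ HL (is_int_scal _ (-1) _ (Hs N)))|
      exact (is_int_scal _ c _ (is_int_exp _ HN'))].
    intros x Hx; cbv beta.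
    replace (f x + -1 * (f x * (1 - exp (- (INR N * x))))) with
      (f x * exp (- (INR N * x))) by ring.
    rewrite Rabs_mult (Rabs_pos_eq (exp _)); [|apply Rlt_le, exp_pos].
    apply Rmult_le_compat_r; [apply Rlt_le, exp_pos|].
    eapply Rle_trans; [apply Hf, Hx|].
    apply div_le; nra. }
  apply Rabs_le_between in B; lra.
- assert (H : is_lim_seq (fun n => c * / INR n) 0).
  { replace (Finite 0) with (Rbar_mult c 0) by (simpl; f_equal; ring).
    apply is_lim_seq_scal_l, (is_lim_seq_inv INR p_infty); [apply is_lim_seq_INR|discriminate]. }
  apply is_lim_seq_minus with L 0; [apply is_lim_seq_const|exact H|].
  rewrite /is_Rbar_minus /is_Rbar_plus /=; do 2 f_equal; ring.
- assert (H : is_lim_seq (fun n => c * / INR n) 0).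
  { replace (Finite 0) with (Rbar_mult c 0) by (simpl; f_equal; ring).
    apply is_lim_seq_scal_l, (is_lim_seq_inv INR p_infty); [apply is_lim_seq_INR|discriminate]. }
  apply is_lim_seq_plus with L 0; [apply is_lim_seq_const|exact H|].
  rewrite /is_Rbar_plus /=; do 2 f_equal; ring.
Qed.

(** The positive power compensates the pole: near 0, x^(a+1) q_m = x^a (1 - x z_m). Beyond 1,
    [q_decay] is used with two spare powers. *)
Lemma pow_q_dominated a m :
  exists c, forall x, 0 < x -> Rabs (x ^ S a * q m x) <= c / (1 + x) ^ 2.
Proof.
destruct (q_decay (S a + 2) m) as [K HK]; destruct (z_bound m) as [L [HL HL']].
assert (0 <= K) by (eapply Rle_trans; [apply Rabs_pos|apply (HK 1); lra]).
(* (1+x)^2 is at most 4 on (0, 1] and at most 4 x^2 beyond. *)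
exists (4 * K + 4 * (1 + L)); intros x Hx.
apply le_div; [nra|].
pose proof (Rabs_pos (x ^ S a * q m x)).
destruct (Rle_dec x 1) as [H1|H1].
- assert (B : Rabs (x ^ S a * q m x) <= 1 + L).
  { replace (x ^ S a * q m x) with (x ^ a * (1 - x * z m x)) by (unfold q; simpl; field; lra).
    assert (B1 : 0 <= x ^ a <= 1).
    { split; [apply pow_le; lra|rewrite -(pow1 a); apply pow_incr; lra]. }
    rewrite Rabs_mult (Rabs_pos_eq (x ^ a)); [|lra].
    assert (Rabs (1 - x * z m x) <= 1 + L).
    { unfold Rminus; eapply Rle_trans; [apply Rabs_triang|].
      rewrite Rabs_R1 Rabs_Ropp Rabs_mult (Rabs_pos_eq x); [|lra].
      assert (Rabs (z m x) <= L).
      { eapply Rle_trans; [apply HL', Hx|]; apply div_le; nra. }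
      pose proof (Rabs_pos (z m x)); nra. }
    pose proof (Rabs_pos (1 - x * z m x)); nra. }
  assert ((1 + x) ^ 2 <= 4) by nra.
  apply Rle_trans with (Rabs (x ^ S a * q m x) * 4); [apply Rmult_le_compat_l; auto|lra].
- specialize (HK x); rewrite pow_add Rmult_assoc (Rmult_comm (x ^ 2)) -Rmult_assoc Rabs_mult in HK.
  rewrite (Rabs_pos_eq (x ^ 2)) in HK; [|nra].
  assert (H2 : 1 <= x) by lra; specialize (HK H2).
  assert ((1 + x) ^ 2 <= 4 * x ^ 2) by nra.
  apply Rle_trans with (Rabs (x ^ S a * q m x) * (4 * x ^ 2)); [apply Rmult_le_compat_l; auto|].
  lra.
Qed.

Lemma q_0_g x : 0 < x -> q 0 x = g x.
Proof. intros Hx; rewrite -G_0 // G_q //; simpl; field. Qed.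

(** A geometric series: g(x) is the sum of e^(-nx) over n >= 1, and the factor removes the terms
    with n > N + 1. *)
Lemma g_truncated x N : 0 < x ->
  g x * (1 - exp (- (INR (S N) * x))) = sum_n (fun n => exp (- (INR (S n) * x))) N.
Proof.
intros Hx; pose proof (exp_gt_1 x Hx).
assert (E : forall n, exp (- (INR n * x)) = (/ exp x) ^ n).
{ induction n as [|n IH]; [simpl; rewrite Rmult_0_l Ropp_0 exp_0; auto|].
  rewrite S_INR; replace (- ((INR n + 1) * x)) with (- (INR n * x) + - x) by ring.
  rewrite exp_plus IH exp_Ropp; simpl; ring. }
induction N as [|N IH].
- rewrite sum_O E; unfold g; simpl; field; lra.
- rewrite sum_Sn -IH !E; unfold g, plus; simpl; field; split; lra.
Qed.

Lemma is_int_sum_n (f : nat -> R -> R) (l : nat -> R) N :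
  (forall n, is_int (f n) (l n)) -> is_int (fun x => sum_n (fun n => f n x) N) (sum_n l N).
Proof.
intros H; induction N as [|N IH].
- rewrite sum_O; eapply is_int_ext; [|apply H]; intros; rewrite sum_O; auto.
- rewrite sum_Sn; eapply is_int_ext; [|exact (is_int_plus _ _ _ _ IH (H (S N)))].
  intros; rewrite sum_Sn; auto.
Qed.

(** The classical Mellin transform Gamma(s) zeta(s) of 1/(e^x - 1), at s = a + 2. *)
Lemma is_int_pow_g a : is_int (fun x => x ^ S a * q 0 x) (fct (S a) * zeta (S (S a))).
Proof.
destruct (pow_q_dominated a 0) as [c Hc].
destruct (ex_int_dominated (fun x => x ^ S a * q 0 x) c) as [L HL]; auto.
{ intros x Hx; apply continuous_Rmult; [apply continuous_pow|apply continuous_q, Hx]. }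
assert (HS : forall N, is_int (fun x => x ^ S a * q 0 x * (1 - exp (- (INR (S N) * x))))
   (sum_n (fun n => fct (S a) * / (INR n + 1) ^ S (S a)) N)).
{ intros N; eapply is_int_ext; [|apply is_int_sum_n with (f := fun n x => x ^ S a * exp (- (INR (S n) * x)))].
  - intros x Hx; cbv beta; rewrite q_0_g // Rmult_assoc g_truncated //.
    apply (sum_n_mult_l (K := R_Ring)).
  - intros n; rewrite -S_INR; apply is_int_pow_exp, lt_0_INR; lia. }
assert (Hlim : is_lim_seq (sum_n (fun n => fct (S a) * / (INR n + 1) ^ S (S a))) L).
(* The truncation index starts at N = 0, where the integrand vanishes, whereas [sum_n] at 0 already
   has one term; [s] absorbs this shift. *)
{ pose (s := fun N => match N with O => 0 | S N => sum_n (fun n => fct (S a) * / (INR n + 1) ^ S (S a)) N end).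
  apply (is_lim_seq_ext (fun n => s (S n))); [reflexivity|].
  apply (proj1 (is_lim_seq_incr_1 s L)), (lim_truncated_int _ c L s Hc HL).
  intros [|N]; [|apply HS].
  apply is_int_eq with (0 * L); [|apply Rmult_0_l].
  eapply is_int_ext; [|apply is_int_scal, HL].
  intros x _; cbv beta; replace (- (INR 0 * x)) with 0 by (simpl; ring); rewrite exp_0; ring. }
apply is_int_eq with L; auto.
unfold zeta; rewrite -Series_scal_l; symmetry; apply is_series_unique; exact Hlim.
Qed.

(** Integrating the derivative of x^(a+2) q_m to 0 multiplies the value by (a+2+m)/(m+1) at each
    step, which is the growth of the binomial coefficient. *)
Lemma is_int_pow_q a m :
  is_int (fun x => x ^ S a * q m x) (Binomial.C (S a + m) m * (fct (S a) * zeta (S (S a)))).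
Proof.
induction m as [|m IH].
- rewrite C_n_0 Rmult_1_l; apply is_int_pow_g.
- assert (H : is_int (fun x => x ^ S a * (INR (S (S a) + m) * q m x - INR (S m) * q (S m) x)) (0 - 0)).
  { apply is_int_FTC with (fun x => x ^ S (S a) * q m x).
    - intros x Hx; apply is_derive_pow_q, Hx.
    - intros x Hx; apply continuous_pow_q, Hx.
    - pose proof (right_pow_q (S a) m) as Hr; rewrite pow_i in Hr; [exact Hr|lia].
    - apply q_lim. }
  assert (INR (S m) <> 0) by (apply not_0_INR; lia).
  pose proof (is_int_plus _ _ _ _ (is_int_scal _ (- / INR (S m)) _ H)
    (is_int_scal _ (INR (S (S a) + m) / INR (S m)) _ IH)) as E.
  eapply is_int_eq; [eapply is_int_ext; [|exact E]|].
  + intros x Hx; cbv beta; field; auto.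
  + unfold Binomial.C.
    replace (S a + S m - S m)%nat with (S a) by lia.
    replace (S a + m - m)%nat with (S a) by lia.
    replace (S a + S m)%nat with (S (S a + m)) by lia.
    replace (S (S a) + m)%nat with (S (S a + m)) by lia.
    rewrite (fact_simpl (S a + m)) (fact_simpl m) !mult_INR; field.
    repeat split; auto; first [apply INR_fact_neq_0|apply not_0_INR; lia].
Qed.

(** * Bernoulli numbers and the product z_k z_0 *)

Lemma bern_gen_opp t : bern_gen (- t) = bern_gen t + t.
Proof.
unfold bern_gen; destruct (Req_EM_T t 0) as [->|Ht].
- rewrite Ropp_0; destruct (Req_EM_T 0 0); [ring|tauto].
- destruct (Req_EM_T (- t) 0); [lra|].
  assert (exp t - 1 <> 0) by (intros E; apply Ht, exp_inv; rewrite exp_0; lra).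
  rewrite exp_Ropp; pose proof (exp_pos t); field; repeat split; auto; lra.
Qed.

Lemma Bernoulli_0 : Bernoulli 0 = 1.
Proof. unfold Bernoulli, bern_gen; simpl; destruct (Req_EM_T 0 0); auto; lra. Qed.

(** The n-th derivative at 0 of b(-t) = b(t) + t, where the extra t contributes only for n = 1. *)
Lemma Bernoulli_parity n :
  (-1) ^ n * Bernoulli n = Bernoulli n + (if Nat.eqb n 1 then 1 else 0).
Proof.
pose (F := fun n t => Derive_n bern_gen n t +
  match n with O => t | S O => 1 | _ => 0 end).
assert (HF : jet (fun _ => True) F).
{ intros m x _; unfold F; apply is_derive_Rplus; [exact (jet_bern m x I)|].
  destruct m as [|[|m]]; auto_derive; auto. }
destruct (jet_Derive_n (fun _ => True) F (fun t => bern_gen (- t)) open_true HF) with n 0 as [_ E]; auto.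
{ intros x _; rewrite bern_gen_opp; unfold F; simpl; auto. }
unfold Bernoulli.
rewrite Derive_n_comp_opp in E.
2:{ exists (mkposreal 1 Rlt_0_1); intros y _ [|k] _; [exact I|].
    eexists; exact (jet_bern k y I). }
rewrite Ropp_0 in E; rewrite E; unfold F; destruct n as [|[|n]]; simpl; ring.
Qed.

Lemma Bernoulli_1 : Bernoulli 1 = - / 2.
Proof. pose proof (Bernoulli_parity 1); simpl in *; lra. Qed.

Lemma Bernoulli_sign j : (2 <= j)%nat -> (-1) ^ j * Bernoulli j = Bernoulli j.
Proof.
intros Hj; rewrite Bernoulli_parity; destruct (Nat.eqb_spec j 1); [lia|ring].
Qed.

Lemma jet_shift (F : nat -> R -> R) (x : R) :
  jet (fun y => 0 < y) F -> jet (fun t => - x < t) (fun n t => F n (x + t)).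
Proof.
intros HF n t Ht; eapply is_derive_eq.
- apply (is_derive_comp (F n) (fun t => x + t)); [apply HF; lra|].
  auto_derive; [exact I|reflexivity].
- apply Rmult_1_l.
Qed.

(* The (k+1)-st derivative at t = 0 of b(t) (g(x) - g(x+t)) = t (g(x) + 1) g(x+t). *)
Lemma G_mul_Bernoulli k x : 0 < x ->
  INR (S k) * ((g x + 1) * G k x) =
  - sum_f_R0 (fun i => Binomial.C (S k) i * (Bernoulli i * G (S k - i) x)) k.
Proof.
intros Hx.
(* The jet of t -> g(x) - g(x+t), on t > -x so that x + t stays positive. It vanishes at t = 0,
   which removes the term i = k + 1 of the Leibniz sum. *)
pose (D := fun n t => match n with O => g x - G 0 (x + t) | S _ => - G n (x + t) end).
assert (HD : jet (fun t => - x < t) D).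
{ intros n t Ht; pose proof (jet_shift _ x jet_G n t Ht) as H; destruct n as [|n]; unfold D.
  - eapply is_derive_eq; [apply (is_derive_Rplus (fun _ => g x) (fun t => - G 0 (x + t)))|].
    + apply: is_derive_const.
    + apply: is_derive_opp; exact H.
    + apply Rplus_0_l.
  - apply: is_derive_opp; exact H. }
assert (HB : jet (fun t => - x < t) (Derive_n bern_gen)).
{ intros n t _; exact (jet_bern n t I). }
assert (HR : jet (fun t => - x < t) (fun n t => (g x + 1) * G n (x + t))).
{ intros n t Ht; apply is_derive_Rscal, (jet_shift _ x jet_G n t Ht). }
pose proof (jet_eq _ _ _ (open_gt (- x)) (jet_mul _ _ _ HB HD) (jet_id_mul _ _ HR)) as E.
assert (E0 : forall t, - x < t -> jmul (Derive_n bern_gen) D 0 t =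
  INR 0 * ((g x + 1) * G (0 - 1) (x + t)) + t * ((g x + 1) * G 0 (x + t))).
{ intros t Ht; unfold jmul, D; simpl sum_f_R0; rewrite C_n_0 G_0; [|lra].
  simpl INR; unfold g, bern_gen, Derive_n.
  assert (exp (x + t) <> 1) by (apply Rgt_not_eq, exp_gt_1; lra).
  assert (exp x <> 1) by (apply Rgt_not_eq, exp_gt_1; lra).
  destruct (Req_EM_T t 0) as [->|Ht0]; [rewrite Rplus_0_r; ring|].
  assert (exp t - 1 <> 0) by (intros E'; apply Ht0, exp_inv; rewrite exp_0; lra).
  rewrite exp_plus in H |- *; field; repeat split; auto; lra. }
specialize (E E0 (S k) 0); cbv beta in E.
assert (Hx0 : - x < 0) by lra; specialize (E Hx0).
rewrite Rplus_0_r Rmult_0_l Rplus_0_r in E.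
replace (S k - 1)%nat with k in E by lia; rewrite -E.
unfold jmul; rewrite tech5 Nat.sub_diag {2}/D Rplus_0_r G_0 //.
rewrite (sum_eq _ (fun i => (Binomial.C (S k) i * (Bernoulli i * G (S k - i) x)) * -1)).
- rewrite -scal_sum; ring.
- intros i Hi; unfold D; destruct (S k - i)%nat eqn:Ei; [lia|].
  rewrite Rplus_0_r; unfold Bernoulli; ring.
Qed.

Notation lsum f l := (fold_right Rplus 0 (map f l)).

Lemma sum_f_R0_lsum (T : nat -> R) n : sum_f_R0 T n = lsum T (seq 0 (S n)).
Proof.
assert (H : forall l a, fold_right Rplus 0 (map T (l ++ a :: nil)) = lsum T l + T a).
{ induction l as [|b l IH]; intros a; simpl; [ring|rewrite IH; ring]. }
induction n as [|n IH]; [simpl; ring|].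
rewrite seq_S H -IH; reflexivity.
Qed.

Lemma lsum_ext (f h : nat -> R) l :
  (forall j, In j l -> f j = h j) -> lsum f l = lsum h l.
Proof.
induction l as [|a l IH]; intros H; simpl; auto.
rewrite H; [|left; auto]; rewrite IH; auto; intros; apply H; right; auto.
Qed.

Definition bern_term (k j : nat) (x : R) : R :=
  Bernoulli j * (-1) ^ j / fct j * (x ^ (j - 1) * q (S k - j) x).

(** The Bernoulli identity rescaled by (-1)^k x^k / ((k+1) k!). The power is written [x ^ j / x]
    because truncated subtraction would falsify [x ^ (j - 1)] at j = 0. *)
Lemma g_mul_q k x : 0 < x ->
  (g x + 1) * q k x =
  sum_f_R0 (fun j => Bernoulli j * (-1) ^ j / fct j * (x ^ j / x * q (S k - j) x)) k.
Proof.
intros Hx; pose proof (G_mul_Bernoulli k x Hx) as E.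
assert (Hk : INR (S k) <> 0) by (apply not_0_INR; lia).
assert (Hxk : x ^ k <> 0) by (apply pow_nonzero; lra).
pose proof pow_minus_1_sqr as Hs.
rewrite G_q // in E.
transitivity ((-1) ^ k * x ^ k / (INR (S k) * fct k) *
  (INR (S k) * ((g x + 1) * ((-1) ^ k * fct k / x ^ k * q k x)))).
{ transitivity ((-1) ^ k * (-1) ^ k * ((g x + 1) * q k x)); [rewrite Hs; ring|].
  field; repeat split; auto; apply INR_fact_neq_0. }
rewrite E Ropp_mult_distr_r_reverse Ropp_mult_distr_l scal_sum.
apply sum_eq; intros i Hi; rewrite G_q //.
unfold Binomial.C; rewrite fact_simpl mult_INR.
assert (Ek : S k = (i + (S k - i))%nat) by lia.
set (m := (S k - i)%nat) in *.
assert (Ex : x ^ k = x ^ i * x ^ m / x).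
{ rewrite -pow_add -Ek; simpl; field; lra. }
assert (Es : (-1) ^ k = - (-1) ^ i * (-1) ^ m).
{ rewrite -Ropp_mult_distr_l -pow_add -Ek; simpl; ring. }
rewrite Ex Es.
transitivity ((-1) ^ m * (-1) ^ m * (Bernoulli i * (-1) ^ i / fct i * (x ^ i / x * q m x))).
2:{ rewrite Hs; ring. }
field; repeat split; auto; try apply INR_fact_neq_0; try lra; apply pow_nonzero; lra.
Qed.

Definition h (x : R) : R := z 0 x / x - q 0 x / 2.

(** After expanding z = 1/x - q, the only product of two [q] is linearised by [g_mul_q]. Its terms j
    = 0 and j = 1, with B_0 = 1 and B_1 = -1/2, enter the explicit part; the others form the sum. *)
Lemma z_mul_z0 k x : 0 < x ->
  z (S k) x * z 0 x =
  h x + (z (S k) x / x - z (S (S k)) x / x) + / 2 * (q 0 x - q (S k) x) +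
  lsum (fun j => bern_term (S k) j x) (seq 2 k).
Proof.
intros Hx; pose proof (g_mul_q (S k) x Hx) as E.
rewrite sum_f_R0_lsum in E; simpl map in E; simpl fold_right in E.
rewrite Bernoulli_0 Bernoulli_1 -q_0_g // in E.
rewrite (lsum_ext (fun j => bern_term (S k) j x)
  (fun j => Bernoulli j * (-1) ^ j / fct j * (x ^ j / x * q (S (S k) - j) x))).
2:{ intros j Hj; apply in_seq in Hj; unfold bern_term.
    destruct j as [|j]; [lia|]; replace (S j - 1)%nat with j by lia.
    simpl pow; field; split; [lra|apply INR_fact_neq_0]. }
assert (Ez : forall m, z m x = / x - q m x) by (intros; unfold q; ring).
set (S0 := fold_right _ _ _) in E |- *.
replace S0 with ((q 0 x + 1) * q (S k) x - q (S (S k)) x / x - q (S k) x / 2).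
- unfold h; rewrite !Ez; field; lra.
- rewrite E; simpl; field; lra.
Qed.

(** For k = 0 the Bernoulli sum stops before j = 1, so a term -q_0/2 survives and pairs with z_0/x
    into a second copy of [h]: the origin of the Kronecker delta. *)
Lemma z0_sqr x : 0 < x -> z 0 x * z 0 x = 2 * h x - z 1 x / x.
Proof.
intros Hx; pose proof (g_mul_q 0 x Hx) as E; simpl in E.
rewrite Bernoulli_0 -q_0_g // in E.
assert (Ez : forall m, z m x = / x - q m x) by (intros; unfold q; ring).
unfold h; rewrite !Ez.
replace (q 1 x) with (x * ((q 0 x + 1) * q 0 x)); [field; lra|].
rewrite E; field; lra.
Qed.

Lemma is_int_lsum (f : nat -> R -> R) (v : nat -> R) l :
  (forall j, In j l -> is_int (f j) (v j)) ->
  is_int (fun x => lsum (fun j => f j x) l) (lsum v l).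
Proof.
induction l as [|a l IH]; intros H; simpl.
(* The zero integrand is written as 0 times one whose integral is known. *)
- apply is_int_eq with (0 * - / 2); [|ring].
  eapply is_int_ext; [|apply is_int_scal, is_int_P_1]; intros; cbv beta; ring.
- apply is_int_plus; [apply H; left; auto|apply IH; intros; apply H; right; auto].
Qed.

(** The Mellin integral at s = j carries (j-1)!, which against 1/j! leaves 1/j; the sign (-1)^j
    disappears because odd Bernoulli numbers vanish from index 3 on. *)
Lemma is_int_bern_term k j : (2 <= j <= k)%nat ->
  is_int (bern_term k j) (Binomial.C k (j - 1) * zeta j * Bernoulli j / INR j).
Proof.
intros Hj; unfold bern_term.
destruct j as [|[|a]]; try lia.
replace (S (S a) - 1)%nat with (S a) by lia.
eapply is_int_eq; [apply is_int_scal, is_int_pow_q|].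
replace (S a + (S k - S (S a)))%nat with k by lia.
unfold Binomial.C; replace (k - (S k - S (S a)))%nat with (S a) by lia.
replace (S k - S (S a))%nat with (k - S a)%nat by lia.
transitivity (((-1) ^ S (S a) * Bernoulli (S (S a))) / fct (S (S a)) *
  (fct k / (fct (k - S a) * fct (S a)) * (fct (S a) * zeta (S (S a))))).
{ unfold Rdiv; ring. }
rewrite Bernoulli_sign; [|lia].
rewrite (fact_simpl (S a)) mult_INR; field.
repeat split; first [apply INR_fact_neq_0|apply not_0_INR; lia].
Qed.

(** For k >= 1 the value 1/(2k) of the integral of z_k/x cancels the last term of H_k/2, which is
    why the index k - 1 appears. At k = 0 truncated subtraction gives [harmonic 0 = 0], matching
    H_{-1} = 0. *)
Lemma is_int_z_mul_z0 k H : is_int h H ->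
  is_int (fun x => z k x * z 0 x)
    ((1 + kron0 k) * H - / (2 * INR (k + 1)) - harmonic (k - 1) / 2 +
     lsum (fun j => Binomial.C k (j - 1) * zeta j * Bernoulli j / INR j) (seq 2 (k - 1))).
Proof.
intros HH; destruct k as [|k].
- eapply is_int_eq; [eapply is_int_ext; [|exact (is_int_plus _ _ _ _
    (is_int_scal _ 2 _ HH) (is_int_scal _ (-1) _ (is_int_z_div 0)))]|].
  + intros x Hx; cbv beta; rewrite z0_sqr //; ring.
  + simpl; field.
- replace (S k - 1)%nat with k by lia.
  pose proof (is_int_lsum (bern_term (S k)) _ (seq 2 k)
    (fun j Hj => is_int_bern_term (S k) j ltac:(apply in_seq in Hj; lia))) as HL.
  pose proof (is_int_plus _ _ _ _ (is_int_z_div k) (is_int_scal _ (-1) _ (is_int_z_div (S k)))) as HZ.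
  eapply is_int_eq; [eapply is_int_ext; [|exact (is_int_plus _ _ _ _ (is_int_plus _ _ _ _
    (is_int_plus _ _ _ _ HH HZ) (is_int_scal _ (/ 2) _ (is_int_q_0k (S k)))) HL)]|].
  + intros x Hx; cbv beta; rewrite z_mul_z0 //; ring.
  + replace (S k + 1)%nat with (S (S k)) by lia; cbn [kron0 harmonic].
    assert (INR (S k) <> 0) by (apply not_0_INR; lia).
    assert (INR (S (S k)) <> 0) by (apply not_0_INR; lia).
    set (L := fold_right _ _ _); field; auto.
Qed.

(** * The integral of h *)

Lemma ln_le_minus_1 x : 0 < x -> ln x <= x - 1.
Proof. intros Hx; pose proof (exp_ineq1_le (ln x)); rewrite exp_ln in H; lra. Qed.

(** ln x <= x - 1 yields both the monotonicity and the lower bound 0. The index is shifted because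
    the term at n = 0 relies on a default value of [ln] and does not fit the decreasing sequence. *)
Lemma is_lim_euler_gamma : is_lim_seq (fun n => harmonic n - ln (INR n)) euler_gamma.
Proof.
assert (H : ex_finite_lim_seq (fun n => harmonic n - ln (INR n))).
{ enough (ex_finite_lim_seq (fun n => harmonic (S n) - ln (INR (S n)))) as [l Hl].
  { exists l; apply (proj2 (is_lim_seq_incr_1 (fun n => harmonic n - ln (INR n)) l)), Hl. }
  assert (L : forall n, ln (INR (S n)) <= harmonic n).
  { induction n as [|n IH]; [simpl; rewrite ln_1; lra|].
    assert (0 < INR (S n)) by (apply lt_0_INR; lia).
    assert (0 < / INR (S n)) by (apply Rinv_0_lt_compat; auto).
    replace (INR (S (S n))) with (INR (S n) * (1 + / INR (S n))).
    2:{ rewrite (S_INR (S n)); field; lra. }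
    rewrite ln_mult; [|auto|lra].
    pose proof (ln_le_minus_1 (1 + / INR (S n))).
    cbn [harmonic]; lra. }
  apply ex_finite_lim_seq_decr with 0; intros n.
  - assert (0 < INR (S n)) by (apply lt_0_INR; lia).
    assert (0 < INR (S (S n))) by (apply lt_0_INR; lia).
    assert (E : ln (INR (S n)) = ln (INR (S (S n))) + ln (INR (S n) / INR (S (S n)))).
    { rewrite -ln_mult; auto; [f_equal; field; lra|apply Rdiv_lt_0_compat; auto]. }
    assert (B : ln (INR (S n) / INR (S (S n))) <= - / INR (S (S n))).
    { eapply Rle_trans; [apply ln_le_minus_1, Rdiv_lt_0_compat; auto|].
      right; rewrite (S_INR (S n)) in H0 |- *; field; lra. }
    change (harmonic (S (S n))) with (harmonic (S n) + / INR (S (S n))); lra.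
  - specialize (L n); cbn [harmonic].
    assert (0 < / INR (S n)) by (apply Rinv_0_lt_compat, lt_0_INR; lia); lra. }
unfold euler_gamma; exact (Lim_seq_correct' _ H).
Qed.

(** Since (1+x)^2 <= 2 + 2 x^2, it suffices to bound x^n e^(-cx) and x^(n+2) e^(-cx). *)
Lemma pow_exp_dominated n c : 0 < c ->
  exists K, forall x, 0 < x -> x ^ n * exp (- (c * x)) <= K / (1 + x) ^ 2.
Proof.
intros Hc; destruct (pow_exp_bound n) as [K HK]; destruct (pow_exp_bound (n + 2)) as [L HL].
exists (2 * (K / c ^ n) + 2 * (L / c ^ (n + 2))); intros x Hx.
apply le_div; [nra|].
pose proof (exp_pos (- (c * x))).
assert (B : forall m M, (forall x, 0 <= x -> x ^ m <= M * exp x) ->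
   x ^ m * exp (- (c * x)) <= M / c ^ m).
{ intros m M HM; assert (0 < c ^ m) by (apply pow_lt; auto).
  apply le_div; auto.
  assert (Hcx : 0 <= c * x) by nra; specialize (HM _ Hcx).
  rewrite Rpow_mult_distr in HM.
  apply Rmult_le_compat_r with (r := exp (- (c * x))) in HM; [|lra].
  rewrite (Rmult_assoc M) -exp_plus Rplus_opp_r exp_0 in HM; lra. }
pose proof (B _ _ HK); pose proof (B _ _ HL).
rewrite (pow_add x n 2) in H1.
assert (0 <= x ^ n * exp (- (c * x))).
{ apply Rmult_le_pos; [apply pow_le; lra|lra]. }
apply Rle_trans with (2 * (x ^ n * exp (- (c * x))) + 2 * (x ^ n * x ^ 2 * exp (- (c * x)))); [|lra].
replace (2 * (x ^ n * exp (- (c * x))) + 2 * (x ^ n * x ^ 2 * exp (- (c * x)))) with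
  (x ^ n * exp (- (c * x)) * (2 + 2 * x ^ 2)) by ring.
apply Rmult_le_compat_l; auto.
pose proof (pow2_ge_0 (1 - x)); lra.
Qed.

(** The mean value theorem in the rate, not in x, produces a factor x that cancels the
    denominator. *)
Lemma exp_diff_bound a b d x : d <= a -> d <= b -> 0 < x ->
  Rabs ((exp (- (a * x)) - exp (- (b * x))) / x) <= Rabs (b - a) * exp (- (d * x)).
Proof.
intros Ha Hb Hx.
destruct (MVT_gen (fun c => exp (- (c * x))) a b (fun c => - x * exp (- (c * x)))) as [c [Hc E]].
- intros c _; auto_derive; [exact I|ring].
- intros c _; apply ex_derive_continuity_pt; auto_derive; exact I.
- replace ((exp (- (a * x)) - exp (- (b * x))) / x) with ((b - a) * exp (- (c * x))).
  2:{ replace (exp (- (a * x)) - exp (- (b * x))) with (x * exp (- (c * x)) * (b - a)) by lra.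
      field; lra. }
  rewrite Rabs_mult (Rabs_pos_eq (exp _)); [|apply Rlt_le, exp_pos].
  apply Rmult_le_compat_l; [apply Rabs_pos|].
  assert (d <= c) by (unfold Rmin in Hc; destruct (Rle_dec a b); lra).
  destruct (Req_dec c d) as [->|Hd]; [lra|].
  apply Rlt_le, exp_increasing; nra.
Qed.

(** With b replaced by a variable u, the integral has derivative 1/u and vanishes at u = a, so it is
    ln u - ln a. Taking u > a/2 leaves room for a two-sided derivative at a and a uniform decay rate
    a/2. *)
Lemma frullani a b : 0 < a < b ->
  is_int (fun x => (exp (- (a * x)) - exp (- (b * x))) / x) (ln b - ln a).
Proof.
intros Hab.
pose (f := fun b x => (exp (- (a * x)) - exp (- (b * x))) / x).
assert (Hex : forall u, a / 2 < u -> is_int (f u) (int (f u))).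
{ intros u Hu; destruct (pow_exp_dominated 0 (a / 2)) as [K HK]; [lra|].
  apply int_correct, (ex_int_dominated _ (Rabs (u - a) * K)).
  - intros x Hx; apply: ex_derive_continuous; unfold f; auto_derive; lra.
  - intros x Hx; unfold f; eapply Rle_trans; [apply exp_diff_bound with (d := a / 2); lra|].
    unfold Rdiv at 2; rewrite Rmult_assoc; apply Rmult_le_compat_l; [apply Rabs_pos|].
    specialize (HK x Hx); simpl in HK |- *; unfold Rdiv in *; lra. }
destruct (pow_exp_dominated 1 (a / 2)) as [K HK]; [lra|].
assert (Hd : forall u, a / 2 < u -> is_derive (fun u => int (f u)) u (/ u)).
{ intros u Hu.
  apply (is_derive_int f (fun u x => exp (- (u * x))) (fun u x => - x * exp (- (u * x)))
    (fun u => int (f u)) (fun u => / u) (a / 2) (u + 1) K); try lra.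
  - intros w x Hw Hx; unfold f; auto_derive; [lra|field; lra].
  - intros w x Hw Hx; auto_derive; [exact I|ring].
  - intros w x Hw Hx; eapply Rle_trans; [|apply HK, Hx].
    rewrite Rabs_mult Rabs_Ropp !Rabs_pos_eq; [|apply Rlt_le, exp_pos|lra].
    rewrite pow_1; apply Rmult_le_compat_l; [lra|].
    apply Rlt_le, exp_increasing; nra.
  - intros w Hw; apply Hex; lra.
  - apply is_int_exp; lra. }
eapply is_int_eq; [apply Hex; lra|].
assert (Ha : int (f a) = 0).
{ apply is_int_unique, is_int_eq with (0 * int (f a)); [|ring].
  eapply is_int_ext; [|apply is_int_scal, Hex with (u := a); lra].
  intros x Hx; unfold f; field; lra. }
destruct (MVT_gen (fun u => int (f u) - ln u) a b (fun _ => 0)) as [c [_ E]].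
- intros u Hu; rewrite Rmin_left in Hu; [|lra].
  eapply is_derive_eq.
  + apply (is_derive_Rplus (fun u => int (f u)) (fun u => - ln u)); [apply Hd; lra|].
    auto_derive; [lra|reflexivity].
  + field; lra.
- intros u Hu; rewrite Rmin_left in Hu; [|lra].
  apply continuity_pt_filterlim; apply (continuous_Rminus (fun u => int (f u)) ln).
  + apply: ex_derive_continuous; exists (/ u); apply Hd; lra.
  + apply: ex_derive_continuous; auto_derive; lra.
- lra.
Qed.

(** Near 0, h = (z_0 - 1/2)/x + z_0/2, whose quotient is bounded by the maximum of |p'| on [0, 1].
    Beyond 1, z_0/x and q_0 are each O(1/x^2). *)
Lemma h_dominated : exists c, forall x, 0 < x -> Rabs (h x) <= c / (1 + x) ^ 2.
Proof.
destruct (continuity_ab_maj (fun x => Rabs (P 1 x)) 0 1) as [M [HM _]]; [lra| |].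
{ intros c _; apply continuity_pt_filterlim.
  apply (continuous_comp (P 1) Rabs); [apply continuous_P|apply: continuous_Rabs]. }
destruct (z_bound 0) as [K [HK0 HK]]; destruct (q_decay 2 0) as [L HL].
assert (0 <= L) by (eapply Rle_trans; [apply Rabs_pos|apply (HL 1); lra]).
pose proof (Rabs_pos (P 1 M)) as HP.
exists (4 * (Rabs (P 1 M) + K) + (2 * K + 4 * L)); intros x Hx.
destruct (Rle_dec x 1) as [H1|H1].
- assert (B : Rabs (z 0 x - / 2) <= Rabs (P 1 M) * x).
  { destruct (MVT_gen (z 0) 0 x (P 1)) as [c [Hc E]].
    - intros y _; apply (is_derive_Rext (P 0)); [intros t; symmetry; apply z_0_x|apply is_derive_P].
    - intros y _; apply continuity_pt_filterlim, continuous_z.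
    - rewrite z_0_0 in E; rewrite E Rabs_mult (Rabs_pos_eq (x - 0)); [|lra].
      rewrite Rmin_left in Hc; [|lra]; rewrite Rmax_right in Hc; [|lra].
      rewrite Rminus_0_r; apply Rmult_le_compat_r; [lra|apply HM; lra]. }
  assert (Bz : Rabs (z 0 x) <= K).
  { eapply Rle_trans; [apply HK, Hx|]; apply div_le; nra. }
  assert (B2 : Rabs (h x) <= Rabs (P 1 M) + K).
  { replace (h x) with ((z 0 x - / 2) / x + z 0 x / 2) by (unfold h, q; field; lra).
    eapply Rle_trans; [apply Rabs_triang|]; apply Rplus_le_compat.
    - unfold Rdiv; rewrite Rabs_mult Rabs_inv (Rabs_pos_eq x); [|lra].
      apply div_le; lra.
    - unfold Rdiv; rewrite Rabs_mult (Rabs_pos_eq (/ 2)); [|lra].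
      pose proof (Rabs_pos (z 0 x)); lra. }
  apply le_div; [nra|].
  pose proof (Rabs_pos (h x)).
  apply Rle_trans with (Rabs (h x) * 4); [apply Rmult_le_compat_l; auto; nra|lra].
- assert (Hx1 : 1 <= x) by lra; specialize (HL x Hx1); specialize (HK x Hx).
  apply le_div; [nra|].
  assert (Bq : Rabs (q 0 x) * (1 + x) ^ 2 <= 4 * L).
  { rewrite Rabs_mult (Rabs_pos_eq (x ^ 2)) in HL; [|nra].
    apply Rle_trans with (Rabs (q 0 x) * (4 * x ^ 2)); [|lra].
    apply Rmult_le_compat_l; [apply Rabs_pos|nra]. }
  assert (Bz : Rabs (z 0 x / x) * (1 + x) ^ 2 <= 2 * K).
  { unfold Rdiv; rewrite Rabs_mult Rabs_inv (Rabs_pos_eq x); [|lra].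
    apply Rmult_le_compat_r with (r := 1 + x) in HK; [|lra].
    unfold Rdiv in HK; rewrite Rmult_assoc Rinv_l in HK; [|lra].
    replace (Rabs (z 0 x) * / x * (1 + x) ^ 2) with (Rabs (z 0 x) * (1 + x) * ((1 + x) / x)) by (field; lra).
    rewrite (Rmult_comm 2); apply Rmult_le_compat; try lra.
    - apply Rmult_le_pos; [apply Rabs_pos|lra].
    - apply Rlt_le, Rdiv_lt_0_compat; lra.
    - apply div_le; lra. }
  assert (Bh : Rabs (h x) <= Rabs (z 0 x / x) + Rabs (q 0 x)).
  { unfold h, Rminus; eapply Rle_trans; [apply Rabs_triang|].
    rewrite Rabs_Ropp; unfold Rdiv at 2; rewrite (Rabs_mult (q 0 x)) (Rabs_pos_eq (/ 2)); [|lra].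
    pose proof (Rabs_pos (q 0 x)); lra. }
  apply Rle_trans with ((Rabs (z 0 x / x) + Rabs (q 0 x)) * (1 + x) ^ 2); [apply Rmult_le_compat_r; auto; nra|].
  nra.
Qed.

Lemma continuous_h x : 0 < x -> continuous h x.
Proof.
intros Hx; apply continuous_Rminus.
- apply continuous_Rmult; [apply continuous_z|apply continuous_Rinv, Rgt_not_eq, Hx].
- apply continuous_Rmult; [apply continuous_q, Hx|apply continuous_const].
Qed.

(** The primitive e^(-Nx) (e^(-x) - 1)/x runs from -1 to 0. This integration by parts trades the
    1/x^2 of [h_exp] for a Frullani integrand. *)
Lemma is_int_exp_quotient N :
  is_int (fun x => exp (- (INR N * x)) * ((1 - exp (- x) - x * exp (- x)) / x ^ 2)
     + INR N * ((exp (- (INR N * x)) - exp (- (INR (S N) * x))) / x)) 1.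
Proof.
assert (Hs : forall x, exp (- (INR (S N) * x)) = exp (- (INR N * x)) * exp (- x)).
{ intros x; rewrite -exp_plus S_INR; f_equal; ring. }
apply is_int_eq with (0 - -1); [|ring].
apply is_int_FTC with (fun x => exp (- (INR N * x)) * ((exp (- x) - 1) / x)).
- intros x Hx; rewrite Hs; auto_derive; [lra|field; lra].
- intros x Hx; apply: ex_derive_continuous; auto_derive; repeat split; try lra.
  apply Rgt_not_eq; nra.
(* The entire series [expd1] supplies the continuous extension to 0. *)
- apply filterlim_right_ext with (fun x => exp (- (INR N * x)) * - expd1 (- x)).
  { intros x Hx; pose proof (expd1_exp (- x)); f_equal.
    replace (exp (- x) - 1) with (- x * expd1 (- x)) by auto; field; lra. }
  apply continuous_right_limit.
  2:{ pose proof (expd2_expd1 0); rewrite Rmult_0_r !Ropp_0 exp_0; lra. }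
  apply continuous_Rmult; [apply: ex_derive_continuous; auto_derive; exact I|].
  apply: ex_derive_continuous; auto_derive.
  exact (proj1 (Cn_expd1 1) _).
- apply (is_lim_0_bound _ 2); intros x Hx.
  rewrite Rabs_mult (Rabs_pos_eq (exp _)); [|apply Rlt_le, exp_pos].
  assert (exp (- (INR N * x)) <= 1).
  { rewrite -exp_0; destruct (Req_dec (INR N * x) 0) as [->|]; [rewrite Ropp_0; lra|].
    apply Rlt_le, exp_increasing; pose proof (pos_INR N); nra. }
  assert (B : Rabs ((exp (- x) - 1) / x) <= 2 / (1 + x)).
  { assert (exp (- x) < 1) by (rewrite -exp_0; apply exp_increasing; lra).
    pose proof (exp_pos (- x)).
    unfold Rdiv; rewrite Rabs_mult Rabs_inv (Rabs_pos_eq x); [|lra].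
    rewrite Rabs_left; [|lra]; apply div_le; [lra|].
    apply Rle_trans with 1; [lra|].
    replace (2 * / (1 + x) * x) with ((2 * x) / (1 + x)) by (field; lra).
    apply le_div; lra. }
  pose proof (exp_pos (- (INR N * x))); pose proof (Rabs_pos ((exp (- x) - 1) / x)); nra.
Qed.

Lemma h_exp x : 0 < x ->
  h x * (1 - exp (- x)) = (1 - exp (- x) - x * exp (- x)) / x ^ 2 - / 2 * exp (- x).
Proof.
intros Hx; unfold h; replace (z 0 x) with (/ x - q 0 x) by (unfold q; ring).
rewrite q_0_g //; unfold g; rewrite exp_Ropp; pose proof (exp_gt_1 x Hx).
field; repeat split; lra.
Qed.

(** From N to N + 1 the integrand grows by e^(-Nx) h(x) (1 - e^(-x)), with integral 1 - N (ln(N+1) -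
    ln N) - 1/(2(N+1)). *)
Lemma is_int_h_truncated N :
  is_int (fun x => h x * (1 - exp (- (INR N * x))))
    (INR N - INR N * ln (INR N) + ln (fct N) - harmonic N / 2).
Proof.
induction N as [|N IH].
- apply is_int_eq with (0 * / 1); [|simpl; rewrite ln_1; field].
  eapply is_int_ext; [|apply is_int_scal, (is_int_exp 1)]; [|lra].
  intros x _; cbv beta; replace (- (INR 0 * x)) with 0 by (simpl; ring).
  rewrite exp_0; ring.
- assert (Hs : forall x, exp (- (INR (S N) * x)) = exp (- (INR N * x)) * exp (- x)).
  { intros x; rewrite -exp_plus S_INR; f_equal; ring. }
  assert (HS : 0 < INR (S N)) by (apply lt_0_INR; lia).
  assert (HF : is_int (fun x => INR N * ((exp (- (INR N * x)) - exp (- (INR (S N) * x))) / x))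
    (INR N * (ln (INR (S N)) - ln (INR N)))).
  (* Frullani's formula requires positive rates; at N = 0 the prefactor makes both sides vanish. *)
  { destruct N as [|N].
    - apply is_int_eq with (0 * / INR 1); [|simpl; ring].
      eapply is_int_ext; [|apply is_int_scal, is_int_exp, HS].
      intros x _; simpl INR; rewrite !Rmult_0_l; auto.
    - apply is_int_scal, frullani; split; [apply lt_0_INR|apply lt_INR]; lia. }
  eapply is_int_eq; [eapply is_int_ext; [|exact (is_int_plus _ _ _ _ IH (is_int_plus _ _ _ _
     (is_int_plus _ _ _ _ (is_int_exp_quotient N) (is_int_scal _ (-1) _ HF))
     (is_int_scal _ (- / 2) _ (is_int_exp _ HS))))]|].
  + intros x Hx; cbv beta; rewrite (Hs x).
    transitivity (h x * (1 - exp (- (INR N * x))) + exp (- (INR N * x)) * (h x * (1 - exp (- x)))); [|ring].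
    rewrite h_exp //; ring.
  + rewrite fact_simpl mult_INR ln_mult; [|exact HS|apply INR_fact_lt_0].
    change (harmonic (S N)) with (harmonic N + / INR (S N)).
    rewrite (S_INR N) in HS |- *; field; lra.
Qed.

(** * Wallis integrals and Stirling's constant *)

Definition W (n : nat) : R := RInt (fun x => sin x ^ n) 0 (PI / 2).

Lemma is_RInt_W n : is_RInt (fun x => sin x ^ n) 0 (PI / 2) (W n).
Proof.
apply (RInt_correct (V := R_CompleteNormedModule)).
apply (ex_RInt_continuous (V := R_CompleteNormedModule)).
intros x _; apply: ex_derive_continuous; auto_derive; exact I.
Qed.

Lemma W_0 : W 0 = PI / 2.
Proof.
unfold W; simpl; rewrite RInt_const; unfold scal; simpl; unfold mult; simpl; ring.
Qed.

Lemma W_1 : W 1 = 1.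
Proof.
apply (is_RInt_unique (V := R_CompleteNormedModule)).
evar_last; [apply (is_RInt_derive (fun x => - cos x) (fun x => sin x ^ 1))|].
- intros x _; auto_derive; [exact I|ring].
- intros x _; apply: ex_derive_continuous; auto_derive; exact I.
- rewrite cos_PI2 cos_0; unfold minus, plus, opp; simpl; ring.
Qed.

(** The primitive cos x sin^(n+1) x vanishes at both ends. *)
Lemma W_SS n : INR (S (S n)) * W (S (S n)) = INR (S n) * W n.
Proof.
assert (E : is_RInt (fun x => INR (S n) * sin x ^ n - INR (S (S n)) * sin x ^ S (S n)) 0 (PI / 2)
  (minus (cos (PI / 2) * sin (PI / 2) ^ S n) (cos 0 * sin 0 ^ S n))).
{ apply (is_RInt_derive (fun x => cos x * sin x ^ S n)).
  - intros x _; eapply is_derive_eq; [apply is_derive_Rmult; [auto_derive; [exact I|reflexivity]|]|].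
    + apply (is_derive_comp (fun y => y ^ S n) sin); [apply is_derive_Rpow|].
      auto_derive; [exact I|reflexivity].
    + unfold scal; simpl Nat.pred; cbn -[INR pow].
      unfold mult; cbn -[INR pow].
      rewrite (S_INR (S n)); pose proof (sin2_cos2 x) as H; unfold Rsqr in H.
      simpl pow.
      transitivity (- (sin x * sin x) * sin x ^ n + INR (S n) * sin x ^ n * (cos x * cos x)); [ring|].
      replace (cos x * cos x) with (1 - sin x * sin x) by lra; ring.
  - intros x _; apply: ex_derive_continuous; auto_derive; exact I. }
assert (E' : is_RInt (fun x => INR (S n) * sin x ^ n - INR (S (S n)) * sin x ^ S (S n)) 0 (PI / 2)
  (INR (S n) * W n - INR (S (S n)) * W (S (S n)))).
{ exact (is_RInt_minus _ _ _ _ _ _ (is_RInt_scal _ _ _ (INR (S n)) _ (is_RInt_W n))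
    (is_RInt_scal _ _ _ (INR (S (S n))) _ (is_RInt_W (S (S n))))). }
apply (is_RInt_unique (V := R_CompleteNormedModule)) in E.
apply (is_RInt_unique (V := R_CompleteNormedModule)) in E'.
rewrite E' cos_PI2 sin_0 Rmult_0_l in E.
rewrite pow_i in E; [|lia].
unfold minus, plus, opp in E; cbn -[INR W] in E; lra.
Qed.

Lemma W_pos n : 0 < W n.
Proof.
assert (H : 0 < W n /\ 0 < W (S n)); [|tauto].
induction n as [|n [H1 H2]].
- rewrite W_0 W_1; pose proof PI_RGT_0; lra.
- split; auto; pose proof (W_SS n) as E.
  assert (0 < INR (S n)) by (apply lt_0_INR; lia).
  assert (0 < INR (S (S n))) by (apply lt_0_INR; lia).
  apply Rmult_lt_reg_l with (INR (S (S n))); auto.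
  rewrite Rmult_0_r E; apply Rmult_lt_0_compat; auto.
Qed.

Lemma W_decr n : W (S n) <= W n.
Proof.
pose proof PI_RGT_0; apply (is_RInt_le (fun x => sin x ^ S n) (fun x => sin x ^ n) 0 (PI / 2));
  try apply is_RInt_W; [lra|].
intros x Hx; assert (0 <= sin x) by (apply sin_ge_0; lra).
pose proof (SIN_bound x); pose proof (pow_le _ n H0); simpl; nra.
Qed.

Lemma W_mul n : INR (S n) * (W n * W (S n)) = PI / 2.
Proof.
induction n as [|n IH].
- rewrite W_0 W_1; simpl; ring.
- rewrite -IH; transitivity (W (S n) * (INR (S (S n)) * W (S (S n)))); [ring|].
  rewrite W_SS; ring.
Qed.

(** As [W] decreases, W_n^2 lies between W_n W_{n+1} and W_{n-1} W_n, both known exactly from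
    [W_mul]. *)
Lemma is_lim_wallis : is_lim_seq (fun n => INR n * W n ^ 2) (PI / 2).
Proof.
apply is_lim_seq_le_le with (fun n => PI / 2 - PI / 2 * / INR (S n)) (fun _ => PI / 2).
- intros n; pose proof (W_mul n) as E1; pose proof (W_decr n); pose proof (W_pos n).
  assert (0 < INR (S n)) by (apply lt_0_INR; lia); split.
  + replace (PI / 2 - PI / 2 * / INR (S n)) with (INR n * (W n * W (S n))).
    2:{ rewrite -{1 2}E1 S_INR in H1 |- *; field; lra. }
    apply Rmult_le_compat_l; [apply pos_INR|]; simpl; rewrite Rmult_1_r.
    apply Rmult_le_compat_l; lra.
  + destruct n as [|n]; [simpl; pose proof PI_RGT_0; lra|].
    rewrite -(W_mul n); apply Rmult_le_compat_l; [apply pos_INR|]; simpl; rewrite Rmult_1_r.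
    apply Rmult_le_compat_r; [lra|apply W_decr].
- evar_last.
  + apply is_lim_seq_minus'; [apply is_lim_seq_const|].
    apply (is_lim_seq_scal_l _ _ 0).
    apply (is_lim_seq_incr_1 (fun n => / INR n)).
    apply (is_lim_seq_inv INR p_infty); [apply is_lim_seq_INR|discriminate].
  + simpl; f_equal; ring.
- apply is_lim_seq_const.
Qed.

Lemma W_even n : W (2 * n) = PI / 2 * fct (2 * n) / (4 ^ n * (fct n * fct n)).
Proof.
induction n as [|n IH].
- simpl; rewrite W_0; field.
- replace (2 * S n)%nat with (S (S (2 * n))) by lia.
  assert (H1 : INR (S (S (2 * n))) <> 0) by (apply not_0_INR; lia).
  apply Rmult_eq_reg_l with (INR (S (S (2 * n)))); auto.
  rewrite W_SS IH !fact_simpl !mult_INR.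
  replace (INR (S (S (2 * n)))) with (2 * INR (S n)) in H1 |- *.
  2:{ rewrite !S_INR mult_INR; simpl; ring. }
  assert (INR (S n) <> 0) by (apply not_0_INR; lia).
  simpl pow; field; repeat split; auto; try apply INR_fact_neq_0.
  apply pow_nonzero; lra.
Qed.

(** Domination already makes Stirling's sequence s_n converge, so only its limit is wanted. In 2 s_n
    - s_{2n}, which has that same limit, the terms n and n ln n cancel up to 2n ln 2, and W_{2n}
    expresses the remaining factorials: the value is ln pi - ln(2n W_{2n}^2)/2, tending to ln(2
    pi)/2. *)
Lemma is_int_h : is_int h Cconst.
Proof.
destruct h_dominated as [c Hc].
destruct (ex_int_dominated h c continuous_h Hc) as [L HL].
pose proof (lim_truncated_int h c L _ Hc HL is_int_h_truncated) as HS.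
pose (s := fun N => INR N - INR N * ln (INR N) + ln (fct N) - / 2 * ln (INR N)).
assert (Hs : is_lim_seq s (L + / 2 * euler_gamma)).
{ refine (is_lim_seq_ext _ _ _ _ (is_lim_seq_plus' _ _ _ _ HS
    (is_lim_seq_scal_l _ (/ 2) euler_gamma is_lim_euler_gamma))).
  intros n; unfold s; simpl; field. }
assert (H2 : is_lim_seq (fun n => s (2 * n)%nat) (L + / 2 * euler_gamma)).
{ apply (is_lim_seq_subseq s _ (fun n => (2 * n)%nat)); auto.
  apply eventually_subseq; intros n; lia. }
assert (HW : is_lim_seq (fun n => ln (INR (2 * n) * W (2 * n) ^ 2)) (ln (PI / 2))).
{ apply (is_lim_seq_continuous ln (fun n => INR (2 * n) * W (2 * n) ^ 2)).
  - apply ex_derive_continuity_pt; auto_derive.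
    pose proof PI_RGT_0; lra.
  - apply (is_lim_seq_subseq (fun n => INR n * W n ^ 2) _ (fun n => (2 * n)%nat)); [|apply is_lim_wallis].
    apply eventually_subseq; intros n; lia. }
assert (E : L + / 2 * euler_gamma = ln PI - / 2 * ln (PI / 2)).
{ assert (X : is_lim_seq (fun n => 2 * s n - s (2 * n)%nat) (2 * (L + / 2 * euler_gamma) - (L + / 2 * euler_gamma))).
  { apply is_lim_seq_minus'; auto; apply (is_lim_seq_scal_l _ 2 (L + / 2 * euler_gamma)), Hs. }
  assert (Y : is_lim_seq (fun n => 2 * s n - s (2 * n)%nat) (ln PI - / 2 * ln (PI / 2))).
  { apply is_lim_seq_ext_loc with (fun n => ln PI - / 2 * ln (INR (2 * n) * W (2 * n) ^ 2)).
    2:{ apply is_lim_seq_minus'; [apply is_lim_seq_const|].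
        apply (is_lim_seq_scal_l _ (/ 2) (ln (PI / 2))), HW. }
    exists 1%nat; intros n Hn; unfold s.
    assert (0 < INR n) by (apply lt_0_INR; lia).
    pose proof PI_RGT_0; pose proof (INR_fact_lt_0 n); pose proof (INR_fact_lt_0 (2 * n)).
    assert (0 < 4 ^ n) by (apply pow_lt; lra).
    assert (0 < PI / 2) by lra.
    assert (Hln4 : ln (4 ^ n) = 2 * INR n * ln 2).
    { rewrite ln_pow; [|lra]; replace 4 with (2 * 2) by ring; rewrite ln_mult; lra. }
    assert (HlnW : ln (W (2 * n)) = ln PI - ln 2 + ln (fct (2 * n)) - 2 * INR n * ln 2 - 2 * ln (fct n)).
    { rewrite W_even ln_div; [|apply Rmult_lt_0_compat; auto|].
      2:{ repeat apply Rmult_lt_0_compat; auto. }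
      rewrite (ln_mult (PI / 2)) // (ln_mult (4 ^ n)) //; [|apply Rmult_lt_0_compat; auto].
      rewrite (ln_mult (fct n)) // Hln4 (ln_div PI); lra. }
    rewrite ln_mult; [|apply lt_0_INR; lia|apply pow_lt, W_pos].
    rewrite ln_pow ?HlnW; [|apply W_pos].
    rewrite mult_INR ln_mult //; [|simpl; lra].
    replace (INR 2) with 2 by (simpl; ring); field. }
  apply is_lim_seq_unique in X; apply is_lim_seq_unique in Y; rewrite X in Y.
  injection Y; lra. }
apply is_int_eq with L; auto; unfold Cconst.
pose proof PI_RGT_0; rewrite ln_div in E; try lra; rewrite ln_mult; lra.
Qed.

(** * The derivatives of A *)

Definition integrand_jet (k : nat) (v x : R) : R := x ^ k * P k (x * v) * p x.

Lemma integrand_jet_z k v x : 0 < v -> 0 < x ->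
  integrand_jet k v x = (-1) ^ k * fct k / v ^ k * (z k (x * v) * z 0 x).
Proof.
intros Hv Hx; unfold integrand_jet; rewrite -z_0_x; unfold z at 2; rewrite Rpow_mult_distr.
assert (v ^ k <> 0) by (apply pow_nonzero; lra).
transitivity ((-1) ^ k * (-1) ^ k * (x ^ k * P k (x * v) * z 0 x)); [rewrite pow_minus_1_sqr; ring|].
field; split; [apply INR_fact_neq_0|auto].
Qed.

(** In terms of [z] the factor x^k is absorbed and two factors O(1/(1+x)) remain; a <= 1 gives 1 +
    xv >= a (1 + x), uniformly in v >= a. *)
Lemma integrand_jet_dominated k a : 0 < a <= 1 ->
  exists c, forall v x, a <= v -> 0 < x -> Rabs (integrand_jet k v x) <= c / (1 + x) ^ 2.
Proof.
intros Ha; destruct (z_bound k) as [K [HK0 HK]]; destruct (z_bound 0) as [L [HL0 HL]].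
exists (fct k / a ^ k * (K / a * L)); intros v x Hv Hx.
rewrite integrand_jet_z; [|lra|auto].
unfold Rdiv at 1; rewrite Rabs_mult (Rabs_mult (z k (x * v))).
rewrite (Rabs_mult _ (/ v ^ k)) (Rabs_mult ((-1) ^ k)) pow_1_abs Rmult_1_l.
rewrite (Rabs_pos_eq (fct k)); [|apply Rlt_le, INR_fact_lt_0].
assert (0 < a ^ k) by (apply pow_lt; lra).
assert (0 < v ^ k) by (apply pow_lt; lra).
rewrite (Rabs_pos_eq (/ v ^ k)); [|apply Rlt_le, Rinv_0_lt_compat; auto].
replace (fct k / a ^ k * (K / a * L) / (1 + x) ^ 2) with
  (fct k * / a ^ k * (K / (a * (1 + x)) * (L / (1 + x)))) by (field; lra).
assert (Hxv : 0 < x * v) by nra.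
pose proof (INR_fact_lt_0 k).
apply Rmult_le_compat.
- apply Rmult_le_pos; [lra|apply Rlt_le, Rinv_0_lt_compat; auto].
- apply Rmult_le_pos; apply Rabs_pos.
- apply Rmult_le_compat_l; [lra|]; apply Rinv_le_contravar; auto; apply pow_incr; lra.
- apply Rmult_le_compat; auto using Rabs_pos.
  eapply Rle_trans; [apply HK, Hxv|].
  apply Rmult_le_compat_l; auto; apply Rinv_le_contravar; nra.
Qed.

Lemma continuous_integrand_jet k v x : continuous (integrand_jet k v) x.
Proof.
apply continuous_Rmult; [apply continuous_Rmult|].
- apply continuous_pow.
- apply: ex_derive_continuous.
  apply (ex_derive_comp (P k) (fun x => x * v)).
  + exists (P (S k) (x * v)); apply is_derive_P.
  + auto_derive; exact I.
- exact (continuous_P 0 x).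
Qed.

Lemma is_derive_integrand_jet k v x :
  is_derive (fun u => integrand_jet k u x) v (integrand_jet (S k) v x).
Proof.
unfold integrand_jet.
apply (is_derive_Rext (fun u => (x ^ k * p x) * P k (x * u))); [intros; ring|].
eapply is_derive_eq.
- apply is_derive_Rscal, (is_derive_comp (P k) (fun u => x * u)); [apply is_derive_P|].
  auto_derive; [exact I|reflexivity].
- unfold scal; simpl; unfold mult; simpl; ring.
Qed.

Lemma is_int_integrand_jet k v : 0 < v ->
  is_int (integrand_jet k v) (int (integrand_jet k v)).
Proof.
intros Hv; assert (Ha : 0 < Rmin v 1 <= 1).
{ split; [apply Rmin_glb_lt; lra|apply Rmin_r]. }
destruct (integrand_jet_dominated k _ Ha) as [c Hc].
apply int_correct, (ex_int_dominated _ c).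
- intros x _; apply continuous_integrand_jet.
- intros x Hx; apply Hc; auto; apply Rmin_l.
Qed.

Lemma jet_int_integrand : jet (fun v => 0 < v) (fun k v => int (integrand_jet k v)).
Proof.
intros k v Hv.
assert (Ha : 0 < Rmin (v / 2) 1 <= 1).
{ split; [apply Rmin_glb_lt; lra|apply Rmin_r]. }
(* [is_derive_int] asks for a majorant of the second derivative in the parameter, two orders above
   [k]; the interval (v/2, v+1) stays away from 0. *)
destruct (integrand_jet_dominated (S (S k)) _ Ha) as [c Hc].
apply (is_derive_int (integrand_jet k) (integrand_jet (S k)) (integrand_jet (S (S k)))
  (fun v => int (integrand_jet k v)) (fun v => int (integrand_jet (S k) v)) (v / 2) (v + 1) c); try lra.
- intros w x _ _; apply is_derive_integrand_jet.
- intros w x _ _; apply is_derive_integrand_jet.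
- intros w x Hw Hx; apply Hc; auto; generalize (Rmin_l (v / 2) 1); lra.
- intros w Hw; apply is_int_integrand_jet; lra.
- apply is_int_integrand_jet, Hv.
Qed.

Lemma is_int_integrandA v : 0 < v -> is_int (integrandA v) (int (integrand_jet 0 v)).
Proof.
intros Hv; eapply is_int_ext; [|apply is_int_integrand_jet, Hv].
intros x Hx; unfold integrand_jet, integrandA; rewrite -!p_phi //; [|nra].
apply f_equal2; [apply Rmult_1_l|reflexivity].
Qed.

(** [RInt_gen] and [Derive_n] have values even without convergence or differentiability, so both are
    established alongside the formula. *)
Theorem theorem2 :
  (forall v : R, 0 < v ->
     ex_RInt_gen (integrandA v) (at_right 0) (Rbar_locally p_infty)) /\
  (forall (k : nat) (v : R), 0 < v -> ex_derive_n A k v) /\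
  (forall k : nat, Derive_n A k 1 = rhs k).
Proof.
assert (HA : forall k v, 0 < v ->
  ex_derive_n A k v /\ Derive_n A k v = int (integrand_jet k v)).
{ apply (jet_Derive_n _ _ _ open_pos jet_int_integrand).
  intros v Hv; exact (is_int_unique _ _ (is_int_integrandA v Hv)). }
split; [|split].
- intros v Hv; eexists; apply is_int_integrandA, Hv.
- intros k v Hv; apply HA, Hv.
- intros k; rewrite (proj2 (HA k 1 Rlt_0_1)); apply is_int_unique.
  eapply is_int_ext; [|apply is_int_scal, (is_int_z_mul_z0 k _ is_int_h)].
  intros x Hx; cbv beta; rewrite integrand_jet_z // ?Rmult_1_r ?pow1; [field|lra].
Qed.
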